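(* A shift space $X$ is a minimal dendric shift over $\mathcal{A}_3=\{1,2,3\}$ if and only if there exist a permutation $\pi_0\in\Sigma_3$, a sequence $(\sigma_n)_{n\ge1}$ of morphisms in $\Sigma_3\mathcal{S}_3\Sigma_3$ and a sequence $(v_n)_{n\ge 1}$ of vertices of the graph $\mathcal{G}$ described below such that, for every $n\ge1$, $\sigma_n$ labels an edge of $\mathcal{G}$ from $v_n$ to $v_{n+1}$, and the directive sequence $(\pi_0,\sigma_1,\sigma_2,\dots)$ is primitive and is an $\mathcal{S}$-adic representation of $X$ (i.e. $X$ is the shift generated by it).
   Context: A shift space over a finite alphabet $\mathcal{A}$ is a closed subset $X\subseteq\mathcal{A}^{\mathbb{Z}}$ invariant under the shift map $S((x_n)_n)=(x_{n+1})_n$, in which every letter of $\mathcal{A}$ occurs; $\mathcal{L}(X)$ is the set of finite words (including the empty word $\varepsilon$) occurring in elements of $X$. $X$ is minimal if the only closed shift-invariant subsets are $\emptyset$ and $X$. For $w\in\mathcal{L}(X)$, the extension graph $\mathcal{E}_X(w)$ is the bipartite graph whose left vertices are the letters $a$ with $aw\in\mathcal{L}(X)$, whose right vertices are the letters $b$ with $wb\in\mathcal{L}(X)$ (left and right copies are disjoint), and with an edge between $a$ and $b$ whenever $awb\in\mathcal{L}(X)$. $X$ is dendric if $\mathcal{E}_X(w)$ is a tree for every $w\in\mathcal{L}(X)$. Morphisms are non-erasing monoid morphisms between free monoids. A directive sequence is a sequence $\boldsymbol\sigma=(\sigma_n:\mathcal{A}_{n+1}^*\to\mathcal{A}_n^*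 )_{n\ge1}$ of morphisms; $\sigma_{[n,N)}=\sigma_n\circ\cdots\circ\sigma_{N-1}$. It is primitive if for every $n$ there is $N>n$ such that every letter of $\mathcal{A}_n$ occurs in $\sigma_{[n,N)}(b)$ for every $b\in\mathcal{A}_N$. For primitive $\boldsymbol\sigma$, $\mathcal{L}^{(n)}(\boldsymbol\sigma)$ is the set of words occurring in some $\sigma_{[n,N)}(a)$, $N>n$, $a\in\mathcal{A}_N$, and the shift generated by $\boldsymbol\sigma$ is $X_{\boldsymbol\sigma}=\{x\in\mathcal{A}_1^{\mathbb{Z}}: \text{every factor of } x \text{ lies in } \mathcal{L}^{(1)}(\boldsymbol\sigma)\}$; $\boldsymbol\sigma$ is then an ($\mathcal{S}$-adic) representation of $X_{\boldsymbol\sigma}$. For $\{a,b,c\}=\{1,2,3\}$, $\pi_{abc}$ is the morphism $1\mapsto a,2\mapsto b,3\mapsto c$; $\Sigma_3$ is the set of these six permutations. Juxtaposition denotes composition. $\mathcal{S}_3=\{\alpha,\beta,\gamma,\eta\}\cup\{\delta^{(k)},\zeta^{(k)}:k\ge1\}$ where $\alpha:1\mapsto1,2\mapsto12,3\mapsto13$; $\beta:1\mapsto1,2\mapsto12,3\mapsto132$; $\gamma:1\mapsto1,2\mapsto12,3\mapsto123$; $\delta^{(k)}:1\mapsto1,2\mapsto123^k,3\mapsto123^{k+1}$; $\zeta^{(k)}:1\mapsto13^k,2\mapsto12,3\mapsto13^{k+1}$; $\eta:1\mapsto13,2\mapsto12,3\mapsto123$. $\Sigma_3\mathcal{S}_3\Sigma_3=\{\pi\sigma\pi':\pi,\pi'\in\Sigma_3,\sigma\in\mathcal{S}_3\}$.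 The graph $\mathcal{G}$ has two vertices $[3,2]$ and $[3,3]$ (and, for each vertex, an entering edge labeled by each permutation, which corresponds to $\pi_0$). Its edges (with $k$ ranging over all integers $\ge1$) are: loops at $[3,2]$ labeled $\alpha$, $\pi_{213}\alpha\pi_{213}$, $\pi_{321}\alpha\pi_{321}$, $\pi_{321}\beta$, $\pi_{312}\beta\pi_{132}$, $\pi_{213}\gamma$, $\pi_{231}\gamma\pi_{132}$, $\pi_{213}\delta^{(k)}$, $\pi_{213}\delta^{(k)}\pi_{132}$, $\pi_{132}\eta$, $\pi_{132}\eta\pi_{231}$, $\pi_{132}\eta\pi_{321}$; loops at $[3,3]$ labeled $\alpha$, $\pi_{213}\alpha\pi_{213}$, $\pi_{321}\alpha\pi_{321}$, $\zeta^{(k)}\pi_{213}$, $\pi_{213}\zeta^{(k)}\pi_{213}$, $\zeta^{(k)}\pi_{231}$, $\pi_{213}\zeta^{(k)}\pi_{231}$; edges from $[3,2]$ to $[3,3]$ labeled $\pi_{312}\beta\pi_{213}$, $\pi_{321}\beta\pi_{312}$, $\pi_{213}\gamma$, $\pi_{231}\gamma\pi_{132}$, $\pi_{213}\delta^{(k)}$, $\pi_{213}\delta^{(k)}\pi_{132}$, $\pi_{132}\eta$; edges from $[3,3]$ to $[3,2]$ labeled $\pi_{312}\beta\pi_{213}$, $\pi_{321}\beta\pi_{213}$, $\pi_{312}\beta\pi_{312}$, $\pi_{321}\beta\pi_{312}$, $\pi_{312}\gamma\pi_{231}$, $\pi_{321}\gamma\pi_{231}$, $\pi_{312}\gamma\pi_{321}$,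 $\pi_{321}\gamma\pi_{321}$, $\zeta^{(k)}\pi_{213}$, $\pi_{213}\zeta^{(k)}\pi_{213}$, $\zeta^{(k)}\pi_{231}$, $\pi_{213}\zeta^{(k)}\pi_{231}$. *)

(* Defs.v *)
From Stdlib Require Import ZArith.
From mathcomp Require Import all_boot.

Set Implicit Arguments.
Unset Strict Implicit.
Unset Printing Implicit Defensive.

(* Alphabet A_3 = {1,2,3}, encoded as 'I_3 with 1 ~ 0, 2 ~ 1, 3 ~ 2.  *)
Definition letter := 'I_3.
Definition o1 : letter := @Ordinal 3 0 isT.
Definition o2 : letter := @Ordinal 3 1 isT.
Definition o3 : letter := @Ordinal 3 2 isT.

Definition word := seq letter.

Definition config := Z -> letter.
Definition cset := config -> Prop.

Definition shift (x : config) : config := fun n => x (n + 1)%Z.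

Definition factor (x : config) (i : Z) (n : nat) : word :=
  mkseq (fun k => x (i + Z.of_nat k)%Z) n.

(* Closedness in the product (Tychonoff) topology of A^Z, A discrete:
   x is in the closure of X iff every central window of x is matched by
   some element of X. *)
Definition closed_set (X : cset) : Prop :=
  forall x : config,
    (forall N : nat, exists y, X y /\
        forall i : Z, (Z.abs i <= Z.of_nat N)%Z -> y i = x i) ->
    X x.

Definition shift_invariant (X : cset) : Prop :=
  forall x : config, X x <-> X (shift x).

Definition shift_space (X : cset) : Prop :=
  [/\ closed_set X, shift_invariant X &
      forall a : letter, exists x, X x /\ exists i : Z, x i = a].

Definition lang (X : cset) (w : word) : Prop :=
  exists x, X x /\ exists i : Z, factor x i (size w) = w.

Definition minimal (X : cset) : Prop :=
  forall Y : cset, (forall x, Y x -> X x) -> closed_set Y -> shift_invariant Y ->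
    (forall x, ~ Y x) \/ (forall x, Y x <-> X x).

(* Vertices: inl a (left copy of a), inr b (right copy of b).          *)
Definition ext_vertex (X : cset) (w : word) (v : letter + letter) : Prop :=
  match v with
  | inl a => lang X (a :: w)
  | inr b => lang X (rcons w b)
  end.

Definition ext_edge (X : cset) (w : word) (u v : letter + letter) : Prop :=
  match u, v with
  | inl a, inr b => lang X (a :: rcons w b)
  | inr b, inl a => lang X (a :: rcons w b)
  | _, _ => False
  end.

Fixpoint walk (T : Type) (e : T -> T -> Prop) (x : T) (p : seq T) : Prop :=
  match p with
  | [::] => True
  | y :: q => e x y /\ walk e y q
  end.

Definition graph_connected (T : Type) (V : T -> Prop) (e : T -> T -> Prop) :=
  forall u v, V u -> V v ->
    exists p : seq T, (forall y, List.In y p -> V y) /\ walk e u p /\ last u p = v.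

Definition graph_acyclic (T : eqType) (V : T -> Prop) (e : T -> T -> Prop) :=
  ~ exists (x : T) (p : seq T),
      [/\ V x, (forall y, List.In y p -> V y), uniq (x :: p),
          1 < size p & walk e x p /\ e (last x p) x].

Definition is_tree (T : eqType) (V : T -> Prop) (e : T -> T -> Prop) :=
  graph_connected V e /\ graph_acyclic V e.

Definition dendric (X : cset) : Prop :=
  forall w : word, lang X w -> is_tree (ext_vertex X w) (ext_edge X w).

(* Morphisms A_3^* -> A_3^* (given by the images of letters).          *)
Definition morph := letter -> word.

Definition mapply (f : morph) (w : word) : word := flatten (map f w).

Definition mcomp (f g : morph) : morph := fun a => mapply f (g a).

Definition mk3 (u v w : word) : morph := fun a => nth [::] [:: u; v; w] a.

Definition perm3 (a b c : letter) : morph := mk3 [:: a] [:: b] [:: c].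

Definition p123 := perm3 o1 o2 o3.
Definition p132 := perm3 o1 o3 o2.
Definition p213 := perm3 o2 o1 o3.
Definition p231 := perm3 o2 o3 o1.
Definition p312 := perm3 o3 o1 o2.
Definition p321 := perm3 o3 o2 o1.

Definition Sigma3 (m : morph) : Prop :=
  m =1 p123 \/ m =1 p132 \/ m =1 p213 \/ m =1 p231 \/ m =1 p312 \/ m =1 p321.

Definition alpha : morph := mk3 [:: o1] [:: o1; o2] [:: o1; o3].
Definition beta  : morph := mk3 [:: o1] [:: o1; o2] [:: o1; o3; o2].
Definition gamma : morph := mk3 [:: o1] [:: o1; o2] [:: o1; o2; o3].
Definition delta (k : nat) : morph :=
  mk3 [:: o1] ([:: o1; o2] ++ nseq k o3) ([:: o1; o2] ++ nseq k.+1 o3).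
Definition zeta (k : nat) : morph :=
  mk3 (o1 :: nseq k o3) [:: o1; o2] (o1 :: nseq k.+1 o3).
Definition eta : morph := mk3 [:: o1; o3] [:: o1; o2] [:: o1; o2; o3].

Definition S3 (m : morph) : Prop :=
  m =1 alpha \/ m =1 beta \/ m =1 gamma \/ m =1 eta \/
  exists k, 0 < k /\ (m =1 delta k \/ m =1 zeta k).

Definition SSS (m : morph) : Prop :=
  exists p s q, [/\ Sigma3 p, S3 s, Sigma3 q & m =1 mcomp p (mcomp s q)].

Notation "f \o3 g" := (mcomp f g) (at level 40, left associativity).

Inductive vtx := V32 (* [3,2] *) | V33 (* [3,3] *).

Definition loop32 (m : morph) : Prop :=
  m =1 alpha \/ m =1 p213 \o3 alpha \o3 p213 \/ m =1 p321 \o3 alpha \o3 p321 \/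
  m =1 p321 \o3 beta \/ m =1 p312 \o3 beta \o3 p132 \/
  m =1 p213 \o3 gamma \/ m =1 p231 \o3 gamma \o3 p132 \/
  (exists k, 0 < k /\ (m =1 p213 \o3 delta k \/ m =1 p213 \o3 delta k \o3 p132)) \/
  m =1 p132 \o3 eta \/ m =1 p132 \o3 eta \o3 p231 \/ m =1 p132 \o3 eta \o3 p321.

Definition loop33 (m : morph) : Prop :=
  m =1 alpha \/ m =1 p213 \o3 alpha \o3 p213 \/ m =1 p321 \o3 alpha \o3 p321 \/
  exists k, 0 < k /\
    (m =1 zeta k \o3 p213 \/ m =1 p213 \o3 zeta k \o3 p213 \/
     m =1 zeta k \o3 p231 \/ m =1 p213 \o3 zeta k \o3 p231).

Definition edge32_33 (m : morph) : Prop :=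
  m =1 p312 \o3 beta \o3 p213 \/ m =1 p321 \o3 beta \o3 p312 \/
  m =1 p213 \o3 gamma \/ m =1 p231 \o3 gamma \o3 p132 \/
  (exists k, 0 < k /\ (m =1 p213 \o3 delta k \/ m =1 p213 \o3 delta k \o3 p132)) \/
  m =1 p132 \o3 eta.

Definition edge33_32 (m : morph) : Prop :=
  m =1 p312 \o3 beta \o3 p213 \/ m =1 p321 \o3 beta \o3 p213 \/
  m =1 p312 \o3 beta \o3 p312 \/ m =1 p321 \o3 beta \o3 p312 \/
  m =1 p312 \o3 gamma \o3 p231 \/ m =1 p321 \o3 gamma \o3 p231 \/
  m =1 p312 \o3 gamma \o3 p321 \/ m =1 p321 \o3 gamma \o3 p321 \/
  exists k, 0 < k /\
    (m =1 zeta k \o3 p213 \/ m =1 p213 \o3 zeta k \o3 p213 \/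
     m =1 zeta k \o3 p231 \/ m =1 p213 \o3 zeta k \o3 p231).

Definition G_edge (u : vtx) (m : morph) (v : vtx) : Prop :=
  match u, v with
  | V32, V32 => loop32 m
  | V33, V33 => loop33 m
  | V32, V33 => edge32_33 m
  | V33, V32 => edge33_32 m
  end.

(* Directive sequences (0-indexed: d 0 = tau_1, d 1 = tau_2, ...).     *)
Fixpoint dcomp (d : nat -> morph) (n k : nat) : morph :=
  match k with
  | 0 => fun a => [:: a]
  | k'.+1 => mcomp (dcomp d n k') (d (n + k'))
  end.

Definition primitive (d : nat -> morph) : Prop :=
  forall n, exists k, 0 < k /\ forall a b : letter, a \in dcomp d n k b.

Definition slang (d : nat -> morph) (w : word) : Prop :=
  exists k (a : letter), 0 < k /\ infix w (dcomp d 0 k a).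

Definition generated_shift (d : nat -> morph) : cset :=
  fun x => forall (i : Z) (n : nat), slang d (factor x i n).

Definition dseq (pi0 : morph) (sigma : nat -> morph) : nat -> morph :=
  fun n => match n with 0 => pi0 | n'.+1 => sigma n' end.

(* Main.v *)
Require Import Defs.
From Stdlib Require Import ZArith.
From mathcomp Require Import all_boot zify.
From Stdlib Require Import ClassicalEpsilon FunctionalExtensionality PropExtensionality Lia.

Set Implicit Arguments.
Unset Strict Implicit.
Unset Printing Implicit Defensive.

(**
For a language L and a letter l, call l a left center when, for every word w and
every letter x such that lw and xw are in L, the letters l and x have a common
right neighbour in the extension graph of w; right centers are symmetric.  A
dendric language on three letters always has a left and a right center, and the
two vertices of the graph record a pair (left center, right center) up to
permutation: (3,2) for [3,2] and (3,3) for [3,3].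

Every morphism of S_3 codes the words between consecutive occurrences of the
letter 1.  A word of the image language either contains no 1, and its extension
graph is explicit, or it is uniquely s sigma(u) 1 p, and then its extension graph
is the image of that of u under two partial maps on letters, one depending on s
and the other on p.  All statements relating the extension graphs of a language
and of its image are thus statements about the 512 bipartite graphs on 3 + 3
vertices, and they are settled by computation.  In one direction, induction on
the length of w, for all levels of the directive sequence at once, shows that all
extension graphs are trees.  In the other direction, the extension graph of the
empty word determines, up to permutation, the return words to a well chosen
letter, the language derived with respect to this letter is again dendric and
uniformly recurrent, and its centers can be chosen so as to follow an edge.
*)

(** Being a tree is not by itself inherited through a morphism. Where only two of the three images
    diverge, the partial map keeps two letters, and a graph restricted to two left vertices stays
    connected only if these have a common neighbour. A center guarantees this for the two pairs that
    contain it, which is why centers enter the induction hypothesis. Conversely, deriving a language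
    only reveals that one particular pair shares. The third letter has a partner in that pair, and
    this partner is a center, but which of the two it is cannot be prescribed. The edges leaving a
    vertex must therefore cover every outcome, and [select_edges] checks that they do. Primitivity
    cannot be read on the labels either, since [alpha] repeated forever fixes the letter 1; when a
    sequence is built from a shift, primitivity is extracted from uniform recurrence. *)

Definition asbool (P : Prop) : bool :=
  if excluded_middle_informative P then true else false.

Lemma asboolP (P : Prop) : reflect P (asbool P).
Proof. by rewrite /asbool; case: excluded_middle_informative => H; constructor. Qed.

(** * Bipartite graphs on 3 + 3 vertices *)

Definition letters : seq letter := [:: o1; o2; o3].

Lemma letter_cases (a : letter) : [\/ a = o1, a = o2 | a = o3].
Proof.
case: a => [[|[|[|//]]]] H.
- by apply: Or31; apply: val_inj.
- by apply: Or32; apply: val_inj.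
- by apply: Or33; apply: val_inj.
Qed.

Lemma mem_letters (a : letter) : a \in letters.
Proof. by case: (letter_cases a) => ->. Qed.

Lemma all_lettersP (P : letter -> bool) : reflect (forall a, P a) (all P letters).
Proof.
apply: (iffP allP) => [H a | H a _]; last exact: H.
exact/H/mem_letters.
Qed.

Lemma has_lettersP (P : letter -> bool) : reflect (exists a, P a) (has P letters).
Proof.
apply: (iffP hasP) => [[a _ H] | [a H]]; first by exists a.
by exists a => //; exact: mem_letters.
Qed.

(* A bipartite graph between two copies of the alphabet is stored as its row-major 3 x 3 adjacency matrix. *)
Definition graph := seq bool.

Definition edge (g : graph) (a b : letter) : bool := nth false g (3 * a + b).

Definition graph_of (r : letter -> letter -> bool) : graph :=
  [seq r a b | a <- letters, b <- letters].

Lemma edge_graph_of r a b : edge (graph_of r) a b = r a b.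
Proof. by case: (letter_cases a) => ->; case: (letter_cases b) => ->. Qed.

Fixpoint bitstrings (n : nat) : seq (seq bool) :=
  if n is n'.+1 then
    [seq true :: s | s <- bitstrings n'] ++ [seq false :: s | s <- bitstrings n']
  else [:: [::]].

Lemma mem_bitstrings (s : seq bool) n : size s = n -> s \in bitstrings n.
Proof.
elim: s n => [|b s IH] [|n] //= [] /IH H.
by rewrite mem_cat; case: b; rewrite map_f ?orbT.
Qed.

Definition graphs := bitstrings 9.

Lemma graph_of_graphs r : graph_of r \in graphs.
Proof. exact: mem_bitstrings. Qed.

Lemma graph_of_edge g : g \in graphs -> graph_of (edge g) = g.
Proof.
have H : all (fun g => graph_of (edge g) == g) graphs by vm_compute.
by move/(allP H)/eqP.
Qed.

Lemma graph_eq g h : g \in graphs -> h \in graphs ->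
  (forall a b, edge g a b = edge h a b) -> g = h.
Proof.
move=> Hg Hh H; rewrite -(graph_of_edge Hg) -(graph_of_edge Hh) /graph_of /=.
by rewrite !H.
Qed.

Definition lvertex (g : graph) a := has (edge g a) letters.
Definition rvertex (g : graph) b := has (edge g ^~ b) letters.

Definition bit (s : seq bool) (a : letter) := nth false s a.

(* Nested conditionals instead of boolean connectives keep [vm_compute] lazy. *)
Definition conn (g : graph) : bool :=
  all (fun A => all (fun B =>
    if all (fun a => all (fun b =>
         if edge g a b then bit A a == bit B b else true) letters) letters then
      if has (fun a => lvertex g a && bit A a) letters || has (fun b => rvertex g b && bit B b) letters
      then all (fun a => lvertex g a ==> bit A a) letters && all (fun b => rvertex g b ==> bit B b) letters
      else true
    else true) (bitstrings 3)) (bitstrings 3).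

Definition no_cycle4 (g : graph) : bool :=
  all (fun a => all (fun b => if edge g a b then
  all (fun a' => if (a' != a) && edge g a' b then
  all (fun b' => if b' != b then ~~ (edge g a b' && edge g a' b') else true) letters
  else true) letters else true) letters) letters.

Definition no_cycle6 (g : graph) : bool :=
  all (fun a => all (fun b => if edge g a b then
  all (fun a' => if (a' != a) && edge g a' b then
  all (fun b' => if (b' != b) && edge g a' b' then
  all (fun a'' => if [&& a'' != a, a'' != a' & edge g a'' b'] then
  all (fun b'' => if (b'' != b) && (b'' != b') then ~~ (edge g a'' b'' && edge g a b'')
   else true) letters else true) letters else true) letters else true)
   letters else true) letters) letters.

(* Among acyclic graphs, connectedness amounts to an Euler characteristic 1 (or to the absence of edges), which is much faster to evaluate than [conn]. *)
Definition treeb (g : graph) : bool :=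
  if no_cycle4 g then if no_cycle6 g then
    ((count id g).+1 == count (lvertex g) letters + count (rvertex g) letters) || ~~ has id g
  else false else false.

Lemma treebE g : g \in graphs -> treeb g = [&& conn g, no_cycle4 g & no_cycle6 g].
Proof.
have H : all (fun g => treeb g == [&& conn g, no_cycle4 g & no_cycle6 g]) graphs by vm_compute.
by move/(allP H)/eqP.
Qed.

Definition share_left a a' (g : graph) : bool :=
  lvertex g a ==> lvertex g a' ==> has (fun b => edge g a b && edge g a' b) letters.
Definition share_right b b' (g : graph) : bool :=
  rvertex g b ==> rvertex g b' ==> has (fun a => edge g a b && edge g a b') letters.
Definition lcenter l g := all (fun x => share_left l x g) letters.
Definition rcenter r g := all (fun x => share_right r x g) letters.
Definition good l r g := [&& treeb g, lcenter l g & rcenter r g].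
(** Graphs in which every pair on either side shares a neighbour: they are compatible with any
    choice of centers, so the words they come from impose nothing. *)
Definition allgood g := treeb g && all (fun x => lcenter x g && rcenter x g) letters.

(** A word outside the language has the edgeless graph, which [treeb] accepts; this predicate tells
    the two situations apart. *)
Definition nonempty (g : graph) := has (fun a => lvertex g a) letters.

Lemma allgood_good l r g : allgood g -> good l r g.
Proof.
case/andP=> H1 /all_lettersP H2; rewrite /good H1.
by have /andP[-> _] := H2 l; have /andP[_ ->] := H2 r.
Qed.

Lemma good_tree l r g : good l r g -> treeb g.
Proof. by case/and3P. Qed.

Lemma nonemptyP g : reflect (exists a b, edge g a b) (nonempty g).
Proof.
apply: (iffP (has_lettersP _)) => [[a /has_lettersP[b H]] | [a [b H]]].
  by exists a, b.
by exists a; apply/has_lettersP; exists b.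
Qed.

(** With a single left vertex, the graph is a star whose center is a neighbour common to all right
    vertices. This disposes of the words that extend in only one way on the left. *)
Lemma star_left g a0 : g \in graphs -> nonempty g ->
  (forall a b, edge g a b -> a = a0) -> allgood g.
Proof.
have H : all (fun g => all (fun a0 => if nonempty g then
   if all (fun a => all (fun b => edge g a b ==> (a == a0)) letters) letters
   then allgood g else true else true) letters) graphs by vm_compute.
move=> Hg ne C; have := allP H g Hg => /all_lettersP/(_ a0); rewrite ne.
case: ifP => // /negP[]; apply/all_lettersP => a; apply/all_lettersP => b.
by apply/implyP => /C ->.
Qed.

Lemma star_right g b0 : g \in graphs -> nonempty g ->
  (forall a b, edge g a b -> b = b0) -> allgood g.
Proof.
have H : all (fun g => all (fun a0 => if nonempty g then
   if all (fun a => all (fun b => edge g a b ==> (b == a0)) letters) letters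
   then allgood g else true else true) letters) graphs by vm_compute.
move=> Hg ne C; have := allP H g Hg => /all_lettersP/(_ b0); rewrite ne.
case: ifP => // /negP[]; apply/all_lettersP => a; apply/all_lettersP => b.
by apply/implyP => /C ->.
Qed.

(** * Trees *)

Definition gvertex (g : graph) (v : letter + letter) : Prop :=
  match v with inl a => lvertex g a | inr b => rvertex g b end.
Definition gedge (g : graph) (u v : letter + letter) : Prop :=
  match u, v with
  | inl a, inr b => edge g a b
  | inr b, inl a => edge g a b
  | _, _ => False
  end.

Definition tabl (P : letter -> bool) : seq bool := [seq P a | a <- letters].
Lemma bit_tabl P a : bit (tabl P) a = P a.
Proof. by case: (letter_cases a) => ->. Qed.

Lemma gedge_vertex g u v : gedge g u v -> gvertex g u /\ gvertex g v.
Proof.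
by case: u v => [a|b] [a'|b'] //= H; split; apply/has_lettersP;
  first [by exists b' | by exists a | by exists a' | by exists b].
Qed.

Lemma walk_rcons T (e : T -> T -> Prop) x p y :
  walk e x p -> e (last x p) y -> walk e x (rcons p y).
Proof. by elim: p x => //= z p IH x [H1 H2] H; split=> //; exact: IH. Qed.

(** [conn] speaks of cuts instead of walks: a pair of vertex sets that no edge crosses and that
    meets the vertices contains them all. A walk cannot leave such a cut, and conversely the cut to
    test is the set of vertices reachable from [u]. *)
Lemma gconnP g : graph_connected (gvertex g) (gedge g) <-> conn g.
Proof.
split=> [C | C u v Vu Vv].
- apply/allP => A _; apply/allP => B _.
  case: ifP => // /all_lettersP cl.
  pose inS (v : letter + letter) := match v with inl a => bit A a | inr b => bit B b end.
  have st u v : gedge g u v -> inS u -> inS v.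
    have cl' a b : edge g a b -> bit A a = bit B b.
      by move=> E; have := cl a => /all_lettersP/(_ b); rewrite E => /eqP.
    by case: u v => [a|b] [a'|b'] //= /cl' ->.
  have stw u p : walk (gedge g) u p -> inS u -> inS (last u p).
    by elim: p u => //= z p IH u [/st H /IH H2] /H.
  have main u : gvertex g u -> inS u -> forall v, gvertex g v -> inS v.
    by move=> Vu Su v Vv; have [p [_ [/stw W <-]]] := C u v Vu Vv; exact: W.
  case: ifP => // H.
  have [u Vu Su] : exists2 u, gvertex g u & inS u.
    case/orP: H => /has_lettersP[a /andP[H1 H2]]; first by exists (inl a).
    by exists (inr a).
  apply/andP; split; apply/all_lettersP => a; apply/implyP => Va.
    exact: (main u Vu Su (inl a)).
  exact: (main u Vu Su (inr a)).
- pose R v := exists p, (forall y, List.In y p -> gvertex g y) /\ walk (gedge g) u p /\ last u p = v.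
  pose A := tabl (fun a => asbool (R (inl a))).
  pose B := tabl (fun b => asbool (R (inr b))).
  have stR v1 v2 : gedge g v1 v2 -> R v1 -> R v2.
    move=> E [p [H1 [H2 H3]]]; exists (rcons p v2); split; last split.
    - move=> y; rewrite -cats1 => /List.in_app_iff[/H1 //|[<-|//]].
      by case: (gedge_vertex E).
    - by apply: walk_rcons => //; rewrite H3.
    - by rewrite last_rcons.
  have HA : A \in bitstrings 3 by exact: mem_bitstrings.
  have HB : B \in bitstrings 3 by exact: mem_bitstrings.
  have := allP C A HA => /allP/(_ B HB).
  case: ifP => [_|/negP[]]; last first.
    apply/all_lettersP => a; apply/all_lettersP => b; case: ifP => // E.
    rewrite !bit_tabl; apply/eqP.
    by apply/asboolP/asboolP; apply: stR.
  have Ru : R u by exists [::].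
  case: ifP => [_|/negP[]]; last first.
    suff H w : gvertex g w -> R w -> has (fun a => lvertex g a && bit A a) letters ||
        has (fun b => rvertex g b && bit B b) letters by exact: H Vu Ru.
    rewrite /A /B; case: w => [a|b] V Rw; apply/orP.
      by left; apply/has_lettersP; exists a; rewrite [lvertex _ _]V bit_tabl /=; apply/asboolP.
    by right; apply/has_lettersP; exists b; rewrite [rvertex _ _]V bit_tabl /=; apply/asboolP.
  case/andP => /all_lettersP H1 /all_lettersP H2.
  case: v Vv => [a|b] /= V.
    by have := H1 a; rewrite /A V bit_tabl => /asboolP.
  by have := H2 b; rewrite /B V bit_tabl => /asboolP.
Qed.

(** Together with bipartiteness, this bound leaves 4 and 6 as the only lengths of cycles. *)
Lemma uniq_size6 (s : seq (letter + letter)) : uniq s -> size s <= 6.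
Proof.
move=> U; have -> : 6 = size ([seq inl a | a <- letters] ++ [seq inr a | a <- letters] : seq (letter + letter)) by [].
apply: uniq_leq_size => // x _; rewrite mem_cat.
by case: x => a; apply/orP; [left|right]; rewrite map_f ?mem_letters.
Qed.

Lemma cyc4P g : reflect (exists a b a' b', [/\ a' != a, b' != b, edge g a b, edge g a' b & edge g a b' && edge g a' b'])
   (~~ no_cycle4 g).
Proof.
apply: (iffP idP).
- case/allPn=> a _ /allPn[b _]; case: ifP => // E1 /allPn[a' _]; case: ifP => // /andP[n1 E2].
  case/allPn=> b' _; case: ifP => // n2; rewrite negbK => E3.
  by exists a, b, a', b'.
- move=> [a [b [a' [b' [n1 n2 E1 E2 E3]]]]].
  apply/allPn; exists a; rewrite ?mem_letters //.
  apply/allPn; exists b; rewrite ?mem_letters //; rewrite E1.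
  apply/allPn; exists a'; rewrite ?mem_letters //; rewrite n1 E2.
  by apply/allPn; exists b'; rewrite ?mem_letters //; rewrite n2 negbK.
Qed.

Lemma cyc6P g : reflect (exists a b a' b' a'' b'',
   [/\ uniq [:: a; a'; a''], uniq [:: b; b'; b''],
     edge g a b && edge g a' b, edge g a' b' && edge g a'' b' & edge g a'' b'' && edge g a b''])
   (~~ no_cycle6 g).
Proof.
apply: (iffP idP).
- case/allPn=> a _ /allPn[b _]; case: ifP => // E1 /allPn[a' _]; case: ifP => // /andP[n1 E2].
  case/allPn=> b' _; case: ifP => // /andP[n2 E3] /allPn[a'' _]; case: ifP => // /and3P[n3 n4 E4].
  case/allPn=> b'' _; case: ifP => // /andP[n5 n6]; rewrite negbK => E5.
  exists a, b, a', b', a'', b''; split=> //=; rewrite ?inE ?E1 ?E2 ?E3 ?E4 ?E5 //.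
    by rewrite negb_or eq_sym n1 eq_sym n3 eq_sym n4.
  by rewrite negb_or eq_sym n2 eq_sym n5 eq_sym n6.
- move=> [a [b [a' [b' [a'' [b'' []]]]]]] /=; rewrite !inE !negb_or.
  move=> /and3P[/andP[n1 n2] n3 _] /and3P[/andP[n4 n5] n6 _].
  move=> /andP[E1 E2] /andP[E3 E4] E5.
  apply/allPn; exists a; rewrite ?mem_letters //.
  apply/allPn; exists b; rewrite ?mem_letters //; rewrite E1.
  apply/allPn; exists a'; rewrite ?mem_letters //; rewrite eq_sym n1 E2.
  apply/allPn; exists b'; rewrite ?mem_letters //; rewrite eq_sym n4 E3.
  apply/allPn; exists a''; rewrite ?mem_letters //; rewrite eq_sym n2 eq_sym n3 E4.
  by apply/allPn; exists b''; rewrite ?mem_letters //; rewrite eq_sym n5 eq_sym n6 negbK.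
Qed.

Lemma gacycP g : graph_acyclic (gvertex g) (gedge g) <-> no_cycle4 g && no_cycle6 g.
Proof.
split=> [A | /andP[N4 N6] [x [p [_ _ U [sp [W C]]]]]].
- apply/andP; split; apply/negPn/negP.
  + move/cyc4P=> [a [b [a' [b' [n1 n2 E1 E2 /andP[E3 E4]]]]]]; apply: A.
    exists (inl a), [:: inr b; inl a'; inr b']; split=> //.
    * exact: (proj1 (@gedge_vertex g (inl a) (inr b) E1)).
    * move=> y [<-|[<-|[<-|//]]].
      - exact: (proj2 (@gedge_vertex g (inl a) (inr b) E1)).
      - exact: (proj1 (@gedge_vertex g (inl a') (inr b) E2)).
      - exact: (proj2 (@gedge_vertex g (inl a') (inr b') E4)).
    * by rewrite /= !inE /= ![inl _ == inl _]/eq_op /= ![inr _ == inr _]/eq_op /= ![a == _]eq_sym [b == _]eq_sym (negbTE n1) (negbTE n2).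
  + move/cyc6P=> [a [b [a' [b' [a'' [b'' [U1 U2 /andP[E1 E2] /andP[E3 E4] /andP[E5 E6]]]]]]]]; apply: A.
    exists (inl a), [:: inr b; inl a'; inr b'; inl a''; inr b'']; split=> //.
    * exact: (proj1 (@gedge_vertex g (inl a) (inr b) E1)).
    * move=> y [<-|[<-|[<-|[<-|[<-|//]]]]].
      - exact: (proj2 (@gedge_vertex g (inl a) (inr b) E1)).
      - exact: (proj1 (@gedge_vertex g (inl a') (inr b) E2)).
      - exact: (proj2 (@gedge_vertex g (inl a') (inr b') E3)).
      - exact: (proj1 (@gedge_vertex g (inl a'') (inr b') E4)).
      - exact: (proj2 (@gedge_vertex g (inl a'') (inr b'') E5)).
    * move: U1 U2; rewrite /= !inE /= ![inl _ == inl _]/eq_op /= ![inr _ == inr _]/eq_op /=.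
      by rewrite !orbF !andbT => /andP[-> ->] /andP[-> ->].
- have := uniq_size6 U.
  (* Edges alternate between the two sides, which kills the odd cycles; an even cycle that starts on
     the right is read from a left vertex instead. *)
  case: p U sp W C => [|y1 [|y2 [|y3 [|y4 [|y5 [|y6 p]]]]]] U //= _.
  + case: x U => a U; case: y1 U => b U; case: y2 U => c U //=; tauto.
  + case: x U => a U; case: y1 U => b U; case: y2 U => c U; case: y3 U => d U //=; try tauto.
    * move: U; rewrite /= !inE /= ![inl _ == inl _]/eq_op /= ![inr _ == inr _]/eq_op /= !orbF !andbT.
      move=> /andP[n1 n2] [E1 [E2 [E3 _]]] E4 _.
      by move/negP: N4; apply; apply/negP/cyc4P; exists a, b, c, d; split=> //; rewrite 1?eq_sym // ?E3 ?E4 ?andbT.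
    * move: U; rewrite /= !inE /= ![inl _ == inl _]/eq_op /= ![inr _ == inr _]/eq_op /= !orbF !andbT.
      move=> /andP[n1 n2] [E1 [E2 [E3 _]]] E4 _.
      by move/negP: N4; apply; apply/negP/cyc4P; exists b, a, d, c; split=> //; rewrite 1?eq_sym // ?E3 ?E4 ?andbT.
  + case: x U => a U; case: y1 U => b U; case: y2 U => c U; case: y3 U => d U; case: y4 U => e U //=; tauto.
  + case: x U => a U; case: y1 U => b U; case: y2 U => c U; case: y3 U => d U; case: y4 U => e U; case: y5 U => f U //=; try tauto.
    * move: U; rewrite /= !inE /= ![inl _ == inl _]/eq_op /= ![inr _ == inr _]/eq_op /= !orbF !andbT.
      move=> /andP[n1 /andP[n2 /andP[n3 n4]]] [E1 [E2 [E3 [E4 [E5 _]]]]] E6 _.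
      move/negP: N6; apply; apply/negP/cyc6P; exists a, b, c, d, e, f.
      by split; rewrite /= ?inE ?andbT ?n1 ?n2 ?n3 ?n4 ?E1 ?E2 ?E3 ?E4 ?E5 ?E6.
    * move: U; rewrite /= !inE /= ![inl _ == inl _]/eq_op /= ![inr _ == inr _]/eq_op /= !orbF !andbT.
      move=> /andP[n1 /andP[n2 /andP[n3 n4]]] [E1 [E2 [E3 [E4 [E5 _]]]]] E6 _.
      move/negP: N6; apply; apply/negP/cyc6P; exists b, c, d, e, f, a.
      split; rewrite /= ?inE ?E1 ?E2 ?E3 ?E4 ?E5 ?E6 //.
        by rewrite andbT n2 n4.
      rewrite andbT; move: n1; rewrite !negb_or => /andP[n5 n6].
      by rewrite n3 eq_sym n5 eq_sym n6.
Qed.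

Lemma gtreeP g : g \in graphs -> is_tree (gvertex g) (gedge g) <-> treeb g.
Proof.
move=> gin; rewrite /is_tree treebE // gconnP gacycP; split; first by case=> -> ->.
by case/andP.
Qed.

(** * Languages and desubstitution *)

Ltac cat_norm := rewrite -?cats1 /=; repeat (progress rewrite -?catA /=).

Lemma mapply_cat (f : morph) u v : mapply f (u ++ v) = mapply f u ++ mapply f v.
Proof. by rewrite /mapply map_cat flatten_cat. Qed.

Lemma mapply_cons (f : morph) c v : mapply f (c :: v) = f c ++ mapply f v.
Proof. by []. Qed.

Lemma mapply1 (f : morph) c : mapply f [:: c] = f c.
Proof. by rewrite mapply_cons /= cats0. Qed.

Lemma eq_mapply (f g : morph) : f =1 g -> mapply f =1 mapply g.
Proof. by move=> E w; rewrite /mapply (eq_map E). Qed.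

Lemma mapply_comp (f g : morph) w : mapply (mcomp f g) w = mapply f (mapply g w).
Proof. by elim: w => //= c w IH; rewrite !mapply_cons mapply_cat IH. Qed.

Lemma infix_mapply (f : morph) u v : infix u v -> infix (mapply f u) (mapply f v).
Proof.
case/infixP => [p [s ->]]; rewrite !mapply_cat; apply/infixP.
by exists (mapply f p), (mapply f s).
Qed.

Definition language := word -> Prop.

Lemma language_eq (L M : language) : (forall w, L w <-> M w) -> L = M.
Proof.
by move=> H; apply: functional_extensionality => w; apply: propositional_extensionality.
Qed.

Definition extendable (L : language) : Prop :=
  [/\ forall u w, infix u w -> L w -> L u,
      forall w, L w -> exists a b, L (a :: rcons w b) &
      forall a, L [:: a]].

Definition unif_rec (L : language) : Prop :=
  forall u, L u -> exists N, forall w, L w -> N <= size w -> infix u w.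

(** Excluded middle turns membership in an arbitrary language into a bit, so that every extension
    graph is one of the 512 matrices ranged over by the computations. *)
Definition ext_graph (L : language) (w : word) : graph :=
  graph_of (fun a b => asbool (L (a :: rcons w b))).

Lemma ext_graphP L w a b : reflect (L (a :: rcons w b)) (edge (ext_graph L w) a b).
Proof. by rewrite edge_graph_of; exact: asboolP. Qed.

Lemma ext_graph_in L w : ext_graph L w \in graphs.
Proof. exact: graph_of_graphs. Qed.

Definition image_lang (f : morph) (L : language) : language :=
  fun w => exists u, L u /\ infix w (mapply f u).

Lemma eq_img (f g : morph) L : f =1 g -> image_lang f L = image_lang g L.
Proof. by move=> E; apply: language_eq => w; split=> -[u [H1 H2]]; exists u; move: H2; rewrite (eq_mapply E). Qed.

Lemma img_comp (f g : morph) L : image_lang (mcomp f g) L = image_lang f (image_lang g L).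
Proof.
apply: language_eq => w; split=> [[u [H1 H2]] | [u [[v [H1 H2]] H3]]].
  exists (mapply g u); split; last by rewrite -mapply_comp.
  by exists u; split => //; exact: infix_refl.
exists v; split=> //; rewrite mapply_comp; apply: infix_trans H3 _.
exact: infix_mapply.
Qed.

Section Ok.
Variable L : language.
Hypothesis okL : extendable L.

Lemma ok_infix u w : infix u w -> L w -> L u.
Proof. by case: okL => H _ _; exact: H. Qed.

Lemma ok_ext w : L w -> exists a b, L (a :: rcons w b).
Proof. by case: okL => _ H _; exact: H. Qed.

Lemma ok_letter a : L [:: a].
Proof. by case: okL => _ _ H; exact: H. Qed.

Lemma ok_nil : L [::].
Proof. exact: ok_infix (infix0s _) (ok_letter o1). Qed.

Lemma ok_catl u w : L (u ++ w) -> L u.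
Proof. by apply: ok_infix; exact/prefixW/prefix_prefix. Qed.

Lemma ok_catr u w : L (u ++ w) -> L w.
Proof. by apply: ok_infix; exact/suffixW/suffix_suffix. Qed.

Lemma ok_cons a w : L (a :: w) -> L w.
Proof. by rewrite -cat1s; exact: ok_catr. Qed.

Lemma ok_rcons w a : L (rcons w a) -> L w.
Proof. by rewrite -cats1; exact: ok_catl. Qed.

Lemma ok_extr w : L w -> exists b, L (rcons w b).
Proof. by case/ok_ext => a [b /ok_cons H]; exists b. Qed.

Lemma ok_extl w : L w -> exists a, L (a :: w).
Proof. by case/ok_ext => a [b]; rewrite -rcons_cons => /ok_rcons H; exists a. Qed.

Lemma ok_extn n w : L w -> exists x y, [/\ size x = n, size y = n & L (x ++ w ++ y)].
Proof.
elim: n w => [|n IH] w Lw.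
  by exists [::], [::]; rewrite cats0.
have [a [b /IH[x [y [Hx Hy H]]]]] := ok_ext Lw.
exists (rcons x a), (b :: y); rewrite size_rcons /= Hx Hy; split=> //.
by rewrite cat_rcons -cat_rcons; rewrite -rcons_cons -cats1 -!catA /= in H; rewrite cat_rcons.
Qed.

Lemma lvP w a : reflect (L (a :: w)) (lvertex (ext_graph L w) a).
Proof.
apply: (iffP (has_lettersP _)) => [[b /ext_graphP] | H].
  by rewrite -rcons_cons; exact: ok_rcons.
by have [b Hb] := ok_extr H; exists b; apply/ext_graphP.
Qed.

Lemma rvP w b : reflect (L (rcons w b)) (rvertex (ext_graph L w) b).
Proof.
apply: (iffP (has_lettersP _)) => [[a /ext_graphP] | H].
  exact: ok_cons.
by have [a Ha] := ok_extl H; exists a; apply/ext_graphP.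
Qed.

Lemma ext_nonempty w : L w -> nonempty (ext_graph L w).
Proof.
by case/ok_ext => a [b H]; apply/nonemptyP; exists a, b; exact/ext_graphP.
Qed.

Lemma nonempty_ext w : nonempty (ext_graph L w) -> L w.
Proof.
by move/nonemptyP => [a [b /ext_graphP/ok_cons/ok_rcons]].
Qed.

End Ok.

Lemma notin_cut (m : letter) t R z z2 : m \notin t -> t ++ R = z ++ m :: z2 ->
  exists z', z = t ++ z' /\ R = z' ++ m :: z2.
Proof.
elim: t z => [|c t IH] z /=; first by move=> _ ->; exists z.
rewrite inE negb_or => /andP[n1 n2]; case: z => [|d z] /= [].
  by move=> E; rewrite E eqxx in n1.
by move=> -> /(IH _ n2)[z' [-> ->]]; exists z'.
Qed.

Lemma notin_cut_rev (m : letter) t R z z1 : m \notin t -> R ++ t = z1 ++ m :: z ->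
  exists z', z = z' ++ t /\ R = z1 ++ m :: z'.
Proof.
move=> H /(congr1 rev); rewrite !rev_cat rev_cons cat_rcons => /notin_cut.
rewrite mem_rev => /(_ H)[z' [E1 E2]]; exists (rev z'); split.
  by rewrite -[LHS]revK E1 rev_cat revK.
by rewrite -[LHS]revK E2 rev_cat rev_cons cat_rcons revK.
Qed.

Lemma first_occ (m : letter) w : m \in w -> exists s w', w = s ++ m :: w' /\ m \notin s.
Proof.
elim: w => // c w IH; rewrite inE; case: (eqVneq m c) => [<- _|n /= /IH[s [w' [-> H]]]].
  by exists [::], w.
by exists (c :: s), w'; rewrite inE negb_or n.
Qed.

Lemma last_occ (m : letter) w : m \in w -> exists w' s, w = w' ++ m :: s /\ m \notin s.
Proof.
rewrite -mem_rev => /first_occ[s [w' [E H]]]; exists (rev w'), (rev s).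
by rewrite mem_rev; split=> //; rewrite -[LHS]revK E rev_cat rev_cons cat_rcons.
Qed.

Lemma cat_split (A R z S : word) : A ++ R = z ++ S ->
  (exists k, z = A ++ k /\ R = k ++ S) \/ (exists c k, A = z ++ c :: k /\ S = c :: k ++ R).
Proof.
elim: A z => [|c A IH] [|d z] /=.
- by move=> ->; left; exists [::].
- by move=> ->; left; exists (d :: z).
- by move=> <-; right; exists c, A.
- move=> [<- /IH[[k [-> ->]]|[e [k [-> ->]]]]]; first by left; exists k.
  by right; exists e, k.
Qed.

(** * Morphisms whose images start with a marker: unique desubstitution *)

Section Marker.
Variables (f : morph) (m : letter) (tl : morph).
Hypothesis fE : forall c, f c = m :: tl c.
Hypothesis tlm : forall c, m \notin tl c.
Hypothesis tl_inj : injective tl.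

(** Tails avoid [m], so each occurrence of [m] opens a block. The [m] appended to the image makes
    its end a boundary like the others, which spares a case for the last block. *)
Lemma marker_cut v z1 z2 : mapply f v ++ [:: m] = z1 ++ m :: z2 ->
  exists v1 v2, [/\ v = v1 ++ v2, z1 = mapply f v1 & m :: z2 = mapply f v2 ++ [:: m]].
Proof.
elim: v z1 => [|c v IH] z1.
  case: z1 => [|d z1] /= []; last by case: z1.
  by move=> <-; exists [::], [::].
case: z1 => [|d z1].
  by move=> E; exists [::], (c :: v).
rewrite mapply_cons fE /= -catA => -[<- /(notin_cut (tlm c))[z' [-> /IH[v1 [v2 [-> -> ->]]]]]].
by exists (c :: v1), v2; rewrite mapply_cons fE.
Qed.

Lemma mapply_head u : exists z, mapply f u ++ [:: m] = m :: z.
Proof. by case: u => [|c u]; [exists [::] | rewrite mapply_cons fE /= -catA; eexists]. Qed.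

Lemma tl_cut c d R R' : tl c ++ m :: R = tl d ++ m :: R' -> c = d /\ R = R'.
Proof.
move=> E; have [z' [E1 E2]] := notin_cut (tlm c) E.
case: z' E1 E2 => [|y z']; first by rewrite cats0 => /tl_inj -> [->].
by move=> E1 [E2 _]; have := tlm d; rewrite E1 mem_cat -E2 mem_head orbT.
Qed.

Lemma mapply_inj : injective (mapply f).
Proof.
move=> u v /(congr1 (cat^~ [:: m])).
elim: u v => [|c u IH] [|d v] //=.
- by rewrite mapply_cons fE /= => -[]; case: (tl d) => //= ; case: (mapply f v).
- by rewrite mapply_cons fE /= => -[]; case: (tl c) => //= ; case: (mapply f u).
- rewrite !mapply_cons !fE /= -!catA => -[].
  have [z1 E1] := mapply_head u; have [z2 E2] := mapply_head v.
  by rewrite E1 E2 => /tl_cut[-> E]; rewrite (IH v) // E1 E2 E.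
Qed.

(** The letter [a] read before [s] at the end of the block of [c], and on the other side the letter
    [b] read after [m p] at the start of the block of [d]. The [m] appended to [f d] is the
    beginning of the following block: [b] equals it when [p] is the whole tail. *)
Definition left_letter (s : word) (c a : letter) : bool := suffix (a :: s) (f c).
Definition right_letter (p : word) (d b : letter) : bool := prefix (m :: rcons p b) (rcons (f d) m).

Lemma suffix_block z s a v : m \notin s -> z ++ a :: s = mapply f v ->
  exists v' c, v = rcons v' c /\ left_letter s c a.
Proof.
move=> ms; case/lastP: v => [|v c]; first by case: z.
rewrite -cats1 mapply_cat mapply1 fE -cat_rcons => /(notin_cut_rev ms)[z' [E1 E2]].
exists v, c; rewrite cats1; split=> //; rewrite /left_letter fE E1.
move/(congr1 rev): E2; rewrite rev_rcons => /esym.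
case/lastP: z' {E1} => [|z' x]; rewrite ?rev_cat ?rev_cons ?rev_rcons /= ?cat_rcons => -[-> _].
  exact: suffix_refl.
by rewrite -cat_cons suffix_suffix.
Qed.

Lemma prefix_block p b z v : m \notin p -> mapply f v ++ [:: m] = m :: p ++ b :: z ->
  exists d v', v = d :: v' /\ right_letter p d b.
Proof.
move=> mp; case: v => [|d v]; first by case: p mp.
have [R E] := mapply_head v.
rewrite mapply_cons fE /= -catA E => -[/esym /(notin_cut mp)[z' [E1 E2]]].
exists d, v; split=> //; rewrite /right_letter fE E1 rcons_cons /= eqxx /=.
case: z' E1 E2 => [|x z'] E1 [-> _]; first by rewrite cats0 prefix_refl.
by rewrite -cat_rcons rcons_cat prefix_prefix.
Qed.

Variable L' : language.
Hypothesis okL' : extendable L'.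

Lemma desubst s u p a b : m \notin s -> m \notin p ->
  image_lang f L' (a :: rcons (s ++ mapply f u ++ m :: p) b) <->
  exists c d, [/\ L' (c :: rcons u d), left_letter s c a & right_letter p d b].
Proof.
move=> ms mp; split.
- move=> [v [Lv /infixP[z1 [z2 E]]]].
  (* Even for empty [u], the word [mapply f u ++ [:: m]] begins with [m], so that the left end of
     the middle part can be cut as a block boundary. *)
  have [X EX] := mapply_head u.
  have E0 : mapply f v ++ [:: m] =
      (z1 ++ a :: s) ++ mapply f u ++ m :: p ++ b :: (z2 ++ [:: m]).
    by rewrite E; cat_norm.
  have E' : mapply f v ++ [:: m] = (z1 ++ a :: s) ++ m :: X ++ p ++ b :: (z2 ++ [:: m]).
    by rewrite E0 -(cat1s m (p ++ _)) (catA _ [:: m]) EX.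
  have [v1 [v2 [Ev Ev1 Ev2]]] := marker_cut E'.
  have E2 : mapply f v2 ++ [:: m] = mapply f u ++ m :: p ++ b :: (z2 ++ [:: m]).
    by rewrite -Ev2 -(cat1s m (p ++ _)) (catA _ [:: m]) EX.
  have [u' [v3 [Ev2' /mapply_inj Eu /esym Ev3]]] := marker_cut E2; subst u'.
  have [v1' [c [Ec lc]]] := suffix_block ms Ev1.
  have [d [v3' [Ed rd]]] := prefix_block mp Ev3.
  exists c, d; split=> //; apply: (ok_infix okL') Lv.
  apply/infixP; exists v1', v3'.
  by rewrite Ev Ev2' Ec Ed cat_rcons -cats1 /= -catA.
- move=> [c [d [H /suffixP[y Ey] /prefixP[y' Ey']]]].
  (* The extra letter [e] provides the marker after [f d], which [right_letter] may have to read. *)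
  have [e He] := ok_extr okL' H.
  exists (rcons (c :: rcons u d) e); split=> //.
  have -> : mapply f (rcons (c :: rcons u d) e) = f c ++ mapply f u ++ rcons (f d) m ++ tl e.
    by rewrite -!cats1 mapply_cat mapply_cons mapply_cat !mapply1 (fE e) -!catA.
  rewrite Ey Ey'; apply/infixP; exists y, (y' ++ tl e).
  by cat_norm.
Qed.

Lemma parse v w : infix w (mapply f v) -> m \in w ->
  exists s u p, [/\ w = s ++ mapply f u ++ m :: p, m \notin s & m \notin p].
Proof.
move=> /infixP[z1 [z2 E]] /first_occ[s [w' [Ew ms]]].
have E1 : mapply f v ++ [:: m] = (z1 ++ s) ++ m :: (w' ++ z2 ++ [:: m]).
  by rewrite E Ew; cat_norm.
have [v1 [v2 [_ _ E2]]] := marker_cut E1.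
have [w0 [p [Ew' mp]]] := last_occ (mem_head m w').
have E3 : mapply f v2 ++ [:: m] = w0 ++ m :: (p ++ z2 ++ [:: m]).
  by rewrite -E2 -cat_cons Ew' -catA.
have [u [v3 [_ Eu _]]] := marker_cut E3.
by exists s, u, p; split=> //; rewrite Ew Ew' Eu.
Qed.

Lemma size_mapply u : size u <= size (mapply f u).
Proof.
elim: u => //= c u IH; rewrite mapply_cons fE /= size_cat ltnS.
exact: leq_trans IH (leq_addl _ _).
Qed.

Lemma infix_split w a b A B : m \notin w -> infix (a :: rcons w b) (A ++ m :: B) ->
  infix (a :: rcons w b) (rcons A m) \/ infix (a :: rcons w b) (m :: B).
Proof.
move=> mw /infixP[z1 [z2]] /cat_split[[k [_ ->]]|[c [k [E1]]]].
  by right; apply/infixP; exists k, z2.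
rewrite /= cat_rcons => -[E2] /(notin_cut mw)[z' [E3 E4]]; left.
apply/infixP; rewrite E1 E3 -E2 -cats1.
case: z' E4 {E3} => [|x z'] [-> _].
  by exists z1, [::]; rewrite !cats0 -cats1 -catA.
by exists z1, (z' ++ [:: m]); rewrite -!cats1 -!catA /= -!catA.
Qed.

(** Without a marker inside [w], the word and its two neighbours fit in one block followed by the
    next marker. The extension graph then depends on the morphism only, not on the coded
    language. *)
Lemma desubst_init w a b : m \notin w ->
  image_lang f L' (a :: rcons w b) <-> exists c, infix (a :: rcons w b) (rcons (f c) m).
Proof.
move=> mw; split.
- move=> [v [_ H]]; elim: v H => // c v IH; rewrite mapply_cons.
  case: v IH => [|d v] IH; rewrite ?cats0.
    by move=> H; exists c; apply: infix_trans H (infix_rcons _ _).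
  rewrite {1}mapply_cons (fE d) => /(infix_split mw)[H|H]; first by exists c.
  by apply: IH; rewrite mapply_cons (fE d).
- move=> [c H]; have [d Hd] := ok_extr okL' (ok_letter okL' c).
  exists [:: c; d]; split=> //; apply: infix_trans H _.
  by rewrite mapply_cons mapply1 (fE d) -cat_rcons prefix_infix.
Qed.

Definition graph_image (la ro : letter -> letter -> bool) (g : graph) : graph :=
  graph_of (fun a b => has (fun c => has (fun d =>
    if edge g c d then la c a && ro d b else false) letters) letters).

Lemma graph_imageP (la ro : letter -> letter -> bool) g a b :
  reflect (exists c d, [/\ edge g c d, la c a & ro d b]) (edge (graph_image la ro g) a b).
Proof.
rewrite edge_graph_of; apply: (iffP (has_lettersP _)).
  by move=> [c /has_lettersP[d]]; case: ifP => // H /andP[H1 H2]; exists c, d.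
by move=> [c [d [H1 H2 H3]]]; exists c; apply/has_lettersP; exists d; rewrite H1 H2 H3.
Qed.

Definition initial_graph w := graph_of (fun a b => has (fun c => infix (a :: rcons w b) (rcons (f c) m)) letters).

Lemma img_graph s u p : m \notin s -> m \notin p ->
  ext_graph (image_lang f L') (s ++ mapply f u ++ m :: p) = graph_image (left_letter s) (right_letter p) (ext_graph L' u).
Proof.
move=> ms mp; apply: graph_eq; rewrite ?graph_of_graphs // => a b.
apply/ext_graphP/graph_imageP => [/(desubst _ _ _ ms mp)|] [c [d [H1 H2 H3]]].
  by exists c, d; split=> //; exact/ext_graphP.
by apply/(desubst _ _ _ ms mp); exists c, d; split=> //; exact/ext_graphP.
Qed.

Lemma init_graph w : m \notin w -> ext_graph (image_lang f L') w = initial_graph w.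
Proof.
move=> mw; apply: graph_eq; rewrite ?graph_of_graphs // => a b.
rewrite [RHS]edge_graph_of; apply/ext_graphP/has_lettersP; by rewrite (desubst_init _ _ mw).
Qed.

End Marker.

(** * The basic morphisms *)

Inductive kind := tA | tB | tG | tD | tZ | tE.

Definition kinds := [:: tA; tB; tG; tD; tZ; tE].

Definition basic_morph (t : kind) (k : nat) : morph :=
  match t with
  | tA => alpha | tB => beta | tG => gamma | tE => eta
  | tD => delta k | tZ => zeta k
  end.

Definition basic_tail t k : morph := fun c => behead (basic_morph t k c).

Lemma basic_morphE t k c : basic_morph t k c = o1 :: basic_tail t k c.
Proof. by case: t; case: (letter_cases c) => ->. Qed.

Lemma basic_tail_notin t k c : o1 \notin basic_tail t k c.
Proof.
by case: t; case: (letter_cases c) => -> //; rewrite /basic_tail /= ?inE /= ?mem_nseq ?andbF.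
Qed.

Lemma basic_tail_inj t k : injective (basic_tail t k).
Proof.
have S n : nseq n o3 <> o3 :: nseq n o3.
  by move/(congr1 size)/esym/eqP; rewrite /= !size_nseq; elim: n.
move=> c d; case: t => //; case: (letter_cases c) => ->; case: (letter_cases d) => -> //=;
  rewrite /basic_tail /=; try by case: k.
- by case=> /S.
- by case=> /esym/S.
- by move/S.
- by move/esym/S.
Qed.

(** A partial map on letters seen as a relation; [None] marks a letter without image. *)
Definition tab (x y z : option letter) : letter -> letter -> bool :=
  fun c a => nth None [:: x; y; z] c == Some a.

Definition idtab := tab (Some o1) (Some o2) (Some o3).

(* [left_tables] lists, for each suffix at which the images of two letters diverge, the letter read just before it; [right_tables] is the analogue for prefixes. *)
Definition left_tables (t : kind) : seq (letter -> letter -> bool) :=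
  match t with
  | tA | tG => [:: idtab]
  | tB => [:: tab (Some o1) (Some o2) (Some o2); tab None (Some o1) (Some o3)]
  | tD => [:: tab (Some o1) (Some o3) (Some o3); tab None (Some o2) (Some o3)]
  | tZ => [:: tab (Some o3) (Some o2) (Some o3); tab (Some o1) None (Some o3)]
  | tE => [:: tab (Some o3) (Some o2) (Some o3); tab (Some o1) None (Some o2)]
  end.

Definition right_tables (t : kind) : seq (letter -> letter -> bool) :=
  match t with
  | tA | tB => [:: idtab]
  | tG | tD => [:: tab (Some o1) (Some o2) (Some o2); tab None (Some o1) (Some o3)]
  | tZ => [:: tab (Some o3) (Some o2) (Some o3); tab (Some o1) None (Some o3)]
  | tE => [:: tab (Some o3) (Some o2) (Some o2); tab None (Some o1) (Some o3)]
  end.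

Definition left_nodes (t : kind) k : seq word :=
  match t with
  | tA | tG => [:: [::]]
  | tB => [:: [::]; [:: o2]]
  | tD | tZ => [:: [::]; nseq k o3]
  | tE => [:: [::]; [:: o3]]
  end.

Definition right_nodes (t : kind) k : seq word :=
  match t with
  | tA | tB => [:: [::]]
  | tG | tE => [:: [::]; [:: o2]]
  | tD => [:: [::]; o2 :: nseq k o3]
  | tZ => [:: [::]; nseq k o3]
  end.

Lemma suffix_same (a x : letter) s X : suffix (a :: s) (X ++ x :: s) = (a == x).
Proof. by rewrite -[a :: s]cat1s -[x :: s]cat1s catA suffix_catl // eqxx cats1 -[[:: a]]/(rcons [::] a) suffix_rcons suffix0s andbT. Qed.

Lemma prefix_same (b x : letter) s X : prefix (rcons s b) (s ++ x :: X) = (b == x).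
Proof. by elim: s => [|c s IH] /=; rewrite ?eqxx ?IH // prefix0s andbT. Qed.

Lemma suffix_diff (a x y : letter) s X : x != y -> suffix (a :: rcons s x) (rcons X y) = false.
Proof. by move=> /negbTE n; rewrite -rcons_cons suffix_rcons n. Qed.

Lemma nseq_rcons n (x : letter) : rcons (nseq n x) x = x :: nseq n x.
Proof. by elim: n => //= n ->. Qed.

Lemma letter_eqE (P : letter -> letter -> bool) (Q : letter -> letter -> bool) :
  all (fun a => all (fun b => P a b == Q a b) letters) letters -> P =2 Q.
Proof. by move=> /all_lettersP H a b; have /all_lettersP/(_ b)/eqP := H a. Qed.

Lemma eq_tab (P : letter -> letter -> bool) x y z :
  P o1 =1 (fun a => Some a == x) -> P o2 =1 (fun a => Some a == y) ->
  P o3 =1 (fun a => Some a == z) -> P =2 tab x y z.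
Proof.
by move=> H1 H2 H3 c a; rewrite /tab eq_sym; case: (letter_cases c) => ->; rewrite ?H1 ?H2 ?H3.
Qed.

Lemma deltaE k : [/\ delta k o1 = [:: o1], delta k o2 = o1 :: o2 :: nseq k o3 &
  delta k o3 = o1 :: o2 :: rcons (nseq k o3) o3].
Proof. by rewrite nseq_rcons. Qed.

Lemma zetaE k : [/\ zeta k o1 = o1 :: nseq k o3, zeta k o2 = [:: o1; o2] &
  zeta k o3 = o1 :: rcons (nseq k o3) o3].
Proof. by rewrite nseq_rcons. Qed.

(** The exponent [k] moves the word at which two images diverge, but not the letters read there. The
    tables are thus free of [k], and a finite computation covers the two infinite families. *)
Lemma lam_tab t k i : 0 < k -> i < size (left_tables t) ->
  left_letter (basic_morph t k) (nth [::] (left_nodes t k) i) =2 nth idtab (left_tables t) i.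
Proof.
move=> k0; have [n Ek] : exists n, nseq k o3 = rcons (nseq n o3) o3.
  by exists k.-1; rewrite nseq_rcons; case: k k0.
have [D1 D2 D3] := deltaE k; have [Z1 Z2 Z3] := zetaE k.
case: t => /=; try by case: i => [|[|i]] // _; apply: letter_eqE; vm_compute.
- case: i => [|[|i]] // _ /=; apply: eq_tab => a; rewrite /left_letter /= ?D1 ?D2 ?D3.
  + exact: (@suffix_same a o1 [::] [::]).
  + rewrite Ek -cats1; exact: (@suffix_same a o3 [::] (o1 :: o2 :: _)).
  + rewrite -cats1; exact: (@suffix_same a o3 [::] (o1 :: o2 :: _)).
  + rewrite Ek; exact: (@suffix_diff a o3 o1 _ [::]).
  + exact: (@suffix_same a o2 _ [:: o1]).
  + rewrite nseq_rcons; exact: (@suffix_same a o3 _ [:: o1; o2]).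
- case: i => [|[|i]] // _ /=; apply: eq_tab => a; rewrite /left_letter /= ?Z1 ?Z2 ?Z3.
  + rewrite Ek -cats1; exact: (@suffix_same a o3 [::] (o1 :: _)).
  + exact: (@suffix_same a o2 [::] [:: o1]).
  + rewrite -cats1; exact: (@suffix_same a o3 [::] (o1 :: _)).
  + exact: (@suffix_same a o1 _ [::]).
  + rewrite Ek; exact: (@suffix_diff a o3 o2 _ [:: o1]).
  + rewrite nseq_rcons; exact: (@suffix_same a o3 _ [:: o1]).
Qed.

Lemma rho_tab t k i : 0 < k -> i < size (right_tables t) ->
  right_letter (basic_morph t k) o1 (nth [::] (right_nodes t k) i) =2 nth idtab (right_tables t) i.
Proof.
move=> k0; have [n Ek] : exists n, nseq k o3 = o3 :: nseq n o3.
  by exists k.-1; case: k k0.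
have [D1 D2 D3] := deltaE k; have [Z1 Z2 Z3] := zetaE k.
case: t => /=; try by case: i => [|[|i]] // _; apply: letter_eqE; vm_compute.
- case: i => [|[|i]] // _ /=; apply: eq_tab => a; rewrite /right_letter ?D1 ?D2 ?D3.
  + exact: (@prefix_same a o1 [:: o1] [::]).
  + by rewrite /= ?prefix0s andbT.
  + by rewrite /= ?prefix0s andbT.
  + by [].
  + rewrite -[rcons _ o1]cats1; exact: (@prefix_same a o1 (o1 :: o2 :: nseq k o3) [::]).
  + rewrite -[rcons _ o1]cats1 2!cat_cons cat_rcons.
    exact: (@prefix_same a o3 (o1 :: o2 :: nseq k o3)).
- case: i => [|[|i]] // _ /=; apply: eq_tab => a; rewrite /right_letter ?Z1 ?Z2 ?Z3.
  + by rewrite Ek /= ?prefix0s andbT.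
  + by rewrite /= andbT.
  + by rewrite nseq_rcons /= ?prefix0s andbT.
  + rewrite -[rcons _ o1]cats1; exact: (@prefix_same a o1 (o1 :: nseq k o3) [::]).
  + by rewrite Ek.
  + rewrite -[rcons _ o1]cats1 cat_cons cat_rcons.
    exact: (@prefix_same a o3 (o1 :: nseq k o3)).
Qed.

Lemma lcp_unique (s u : word) a a' x y X Y : a != a' -> x != y ->
  prefix (rcons s a) X -> prefix (rcons s a') Y -> prefix (rcons u x) X -> prefix (rcons u y) Y -> s = u.
Proof.
move=> na nx; elim: s u X Y => [|c s IH] [|d u] [|e X] [|f Y] //=.
- move=> /andP[/eqP <- _] /andP[/eqP <- _] /andP[/eqP Ea _] /andP[/eqP Ea' _].
  by rewrite -Ea -Ea' eqxx in na.
- move=> /andP[/eqP <- _] /andP[/eqP <- _] /andP[/eqP Ea _] /andP[/eqP Ea' _].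
  by rewrite Ea Ea' eqxx in nx.
- move=> /andP[/eqP <- H1] /andP[/eqP <- H2] /andP[/eqP -> H3] /andP[_ H4].
  by rewrite (IH u X Y).
Qed.

Lemma lcs_unique (s u : word) a a' x y X Y : a != a' -> x != y ->
  suffix (a :: s) X -> suffix (a' :: s) Y -> suffix (x :: u) X -> suffix (y :: u) Y -> s = u.
Proof.
move=> na nx; rewrite -!prefix_rev !rev_cons => H1 H2 H3 H4.
by rewrite -[s]revK -[u]revK (lcp_unique na nx H1 H2 H3 H4).
Qed.

Definition functional_const (r : letter -> letter -> bool) :=
  exists a0, forall c a, r c a -> a = a0.

Lemma const_or (r : letter -> letter -> bool) :
  functional_const r \/ exists c c' a a', [/\ a != a', r c a & r c' a'].
Proof.
have [|H] := boolP (has (fun c => has (fun c' => has (fun a => has (fun a' =>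
   [&& a != a', r c a & r c' a']) letters) letters) letters) letters).
  move=> /has_lettersP[c /has_lettersP[c' /has_lettersP[a /has_lettersP[a' /and3P[H1 H2 H3]]]]].
  by right; exists c, c', a, a'.
left; have [|H1] := boolP (has (fun c => has (fun a => r c a) letters) letters).
  move=> /has_lettersP[c /has_lettersP[a Ha]]; exists a => d b Hb.
  apply/eqP/negPn/negP => n; move/negP: H; apply.
  apply/has_lettersP; exists d; apply/has_lettersP; exists c.
  by apply/has_lettersP; exists b; apply/has_lettersP; exists a; apply/and3P.
exists o1 => c a Ha; case/negP: H1; apply/has_lettersP; exists c.
by apply/has_lettersP; exists a.
Qed.

Definition separating (tabs : seq (letter -> letter -> bool)) : bool :=
  all (fun c => all (fun c' => (c != c') ==>
   has (fun i => has (fun x => has (fun y => [&& x != y, nth idtab tabs i c x & nth idtab tabs i c' y])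
     letters) letters) (iota 0 (size tabs))) letters) letters.

(** If two distinct letters can precede [s], they come from distinct blocks [c] and [c']. By the
    [separating] check these two images also diverge at a listed node, and two words diverge from
    the right at one place only, so [s] is that node. *)
Lemma lam_nodes t k s : 0 < k -> functional_const (left_letter (basic_morph t k) s) \/
  exists2 i, i < size (left_tables t) & s = nth [::] (left_nodes t k) i.
Proof.
move=> k0; case: (const_or (left_letter (basic_morph t k) s)) => [|[c [c' [a [a' [na H1 H2]]]]]]; first by left.
right; have n : c != c'.
  apply: contra na => /eqP Ec; rewrite -Ec in H2; move: H1 H2; rewrite /left_letter -!prefix_rev !rev_cons.
  move=> /prefixP[z ->] /prefixP[z']; rewrite !cat_rcons => /eqP.
  by rewrite eqseq_cat // => /andP[_ /eqP[->]].
have /all_lettersP/(_ c)/all_lettersP/(_ c')/implyP/(_ n) : separating (left_tables t) by case: t {H1 H2}; vm_compute.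
case/hasP=> i; rewrite mem_iota => /andP[_ li] /has_lettersP[x /has_lettersP[y /and3P[nx]]].
rewrite -!(lam_tab k0 li) => H3 H4; exists i => //.
exact: lcs_unique na nx H1 H2 H3 H4.
Qed.

Lemma rho_nodes t k s : 0 < k -> functional_const (right_letter (basic_morph t k) o1 s) \/
  exists2 i, i < size (right_tables t) & s = nth [::] (right_nodes t k) i.
Proof.
move=> k0; case: (const_or (right_letter (basic_morph t k) o1 s)) => [|[c [c' [a [a' [na H1 H2]]]]]]; first by left.
right; have n : c != c'.
  apply: contra na => /eqP Ec; rewrite -Ec in H2; move: H1 H2; rewrite /right_letter -!rcons_cons.
  move=> /prefixP[z ->] /prefixP[z']; rewrite !cat_rcons => /eqP.
  by rewrite eqseq_cat // => /andP[_ /eqP[->]].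
have /all_lettersP/(_ c)/all_lettersP/(_ c')/implyP/(_ n) : separating (right_tables t) by case: t {H1 H2}; vm_compute.
case/hasP=> i; rewrite mem_iota => /andP[_ li] /has_lettersP[x /has_lettersP[y /and3P[nx]]].
rewrite -!(rho_tab k0 li) => H3 H4; exists i => //.
by case: (lcp_unique (s := o1 :: s) (u := o1 :: nth [::] (right_nodes t k) i) na nx H1 H2 H3 H4).
Qed.

Lemma lnode_notin t k i : o1 \notin nth [::] (left_nodes t k) i.
Proof. by case: t; case: i => [|[|[|i]]] //=; rewrite mem_nseq andbF. Qed.

Lemma rnode_notin t k i : o1 \notin nth [::] (right_nodes t k) i.
Proof. by case: t; case: i => [|[|[|i]]] //=; rewrite ?inE ?mem_nseq andbF. Qed.

Definition graph_with (s : seq (letter * letter)) : graph := graph_of (fun a b => (a, b) \in s).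

(** The two-letter factors of the words [basic_morph t k c] followed by 1. They do not depend on
    [k >= 1]: thanks to the exponent [k.+1], the factor 33 is present already for [k = 1]. *)
Definition eps_graph (t : kind) : graph :=
  match t with
  | tA => graph_with [:: (o1,o1); (o1,o2); (o1,o3); (o2,o1); (o3,o1)]
  | tB => graph_with [:: (o1,o1); (o1,o2); (o1,o3); (o2,o1); (o3,o2)]
  | tG => graph_with [:: (o1,o1); (o1,o2); (o2,o1); (o2,o3); (o3,o1)]
  | tD => graph_with [:: (o1,o1); (o1,o2); (o2,o3); (o3,o3); (o3,o1)]
  | tZ => graph_with [:: (o1,o3); (o1,o2); (o3,o3); (o3,o1); (o2,o1)]
  | tE => graph_with [:: (o1,o3); (o1,o2); (o3,o1); (o2,o1); (o2,o3)]
  end.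

Lemma infix_cons2 (x c : letter) (w s : word) :
  infix (x :: w) (c :: s) = prefix (x :: w) (c :: s) || infix (x :: w) s.
Proof. by []. Qed.

(* [run_next n j b]: the run of [j] letters 3 opening [3^n 1] is followed by [b]. *)
Definition run_next (n j : nat) (b : letter) : bool :=
  (b == o3) && (j < n) || (b == o1) && (j == n).

Lemma prefix_run n w b : o1 \notin w ->
  prefix (rcons w b) (rcons (nseq n o3) o1) = (w == nseq (size w) o3) && run_next n (size w) b.
Proof.
rewrite /run_next; elim: n w => [|n IH] [|c w] /=.
- by move=> _; case: (letter_cases b) => ->.
- by rewrite inE negb_or eq_sym => /andP[/negbTE-> _]; rewrite ltn0 eqE /= !andbF.
- by move=> _; rewrite prefix0s !andbT; case: (letter_cases b) => ->.
- by rewrite inE negb_or => /andP[_ /IH ->]; rewrite eqseq_cons ltnS eqSS andbA.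
Qed.

Lemma infix_run n w a b : o1 \notin w ->
  infix (a :: rcons w b) (rcons (nseq n o3) o1) =
  [&& a == o3, w == nseq (size w) o3 & has (fun n' => run_next n' (size w) b) (iota 0 n)].
Proof.
move=> nw; elim: n => [|n IH].
  by rewrite /= !andbF orbF; case: w nw => [|c w] _ /=; rewrite andbF.
have -> : iota 0 n.+1 = iota 0 n ++ [:: n] by rewrite -addn1 iotaD.
rewrite has_cat [nseq n.+1 _]/= rcons_cons infix_cons2 IH /= (prefix_run _ _ nw) orbF.
by case: (a == o3); case: (_ == nseq _ _); rewrite //= orbC.
Qed.

Lemma run_nextsP n j b :
  has (fun n' => run_next n' j b) (iota 0 n) = (b == o3) && (j.+1 < n) || (b == o1) && (j < n).
Proof.
apply/hasP/orP => [[n']|].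
- rewrite mem_iota add0n /= => ln /orP[]/andP[-> H]; [left|right] => /=.
    by apply: leq_ltn_trans ln.
  by rewrite (eqP H).
- case=> /andP[Hb H].
    by exists j.+1; rewrite ?mem_iota // /run_next Hb leqnn.
  by exists j; rewrite ?mem_iota // /run_next Hb eqxx orbT.
Qed.

(** The extension graph of the run of [j] letters 3 when maximal runs have length [k] or [k.+1] and
    are preceded by [x], which is 2 for [delta] and 1 for [zeta]. The last two disjuncts describe
    the occurrences preceded by another 3. *)
Definition run_graph (x : letter) k j : graph := graph_of (fun a b =>
  [|| (a == x) && (run_next k j b || run_next k.+1 j b),
      [&& a == o3, b == o3 & j < k] | [&& a == o3, b == o1 & j <= k]]).

(** Only the position of [j] relative to [k] and [k.+1] matters, which leaves finitely many graphs,
    all of them paths when nonempty. *)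
Lemma run_graph_allgood x k j : x != o3 -> nonempty (run_graph x k j) -> allgood (run_graph x k j).
Proof.
rewrite /run_graph /run_next !ltnS; case: (ltngtP j k) => [H|H|->].
- rewrite (ltn_eqF (leqW H)); by case: (letter_cases x) => ->; vm_compute.
- case: (eqVneq j k.+1) => _; by case: (letter_cases x) => ->; vm_compute.
- by rewrite [k == k.+1]ltn_eqF //; case: (letter_cases x) => ->; vm_compute.
Qed.

Lemma has_letters (P : letter -> bool) : has P letters = [|| P o1, P o2 | P o3].
Proof. by rewrite /= orbF. Qed.

Lemma ginit_nil t k : 0 < k -> initial_graph (basic_morph t k) o1 [::] = eps_graph t.
Proof.
move=> k0; have [D1 D2 D3] := deltaE k; have [Z1 Z2 Z3] := zetaE k.
have I n a b : infix [:: a; b] (rcons (nseq n o3) o1) =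
    (a == o3) && ((b == o3) && (1 < n) || (b == o1) && (0 < n)).
  by have := @infix_run n [::] a b isT; rewrite run_nextsP /= .
apply: graph_eq; rewrite ?graph_of_graphs //; first by case: t; exact: graph_of_graphs.
move=> a b; rewrite edge_graph_of has_letters.
case: t; rewrite [basic_morph _ _]/=; try by case: (letter_cases a) => ->; case: (letter_cases b) => ->; vm_compute.
- rewrite D1 D2 D3 !rcons_cons !infix_cons2 !(nseq_rcons k) -![o3 :: nseq k o3]/(nseq k.+1 o3) !I.
  by case: k k0 {D1 D2 D3 Z1 Z2 Z3} => [|[|k]] // _; case: (letter_cases a) => ->; case: (letter_cases b) => ->; vm_compute.
- rewrite Z1 Z2 Z3 !rcons_cons !infix_cons2 !(nseq_rcons k) -![o3 :: nseq k o3]/(nseq k.+1 o3) !I.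
  by case: k k0 {D1 D2 D3 Z1 Z2 Z3} => [|[|k]] // _; case: (letter_cases a) => ->; case: (letter_cases b) => ->; vm_compute.
Qed.

Lemma ginit_edge (f : morph) m w a b :
  edge (initial_graph f m w) a b = has (fun c => infix (a :: rcons w b) (rcons (f c) m)) letters.
Proof. exact: edge_graph_of. Qed.

Lemma short_allgood t k (w : word) : t = tA \/ t = tB \/ t = tG \/ t = tE ->
  o1 \notin w -> w != [::] ->
  nonempty (initial_graph (basic_morph t k) o1 w) -> allgood (initial_graph (basic_morph t k) o1 w).
Proof.
move=> Ht w1 w0 ne.
have sw : size w <= 2.
  move: ne => /nonemptyP[a [b]]; rewrite ginit_edge => /has_lettersP[c /size_infix].
  rewrite /= !size_rcons !ltnS => H; rewrite -ltnS; apply: leq_trans H _.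
  by case: Ht => [|[|[|]]] ->; case: (letter_cases c) => ->.
suff : nonempty (initial_graph (basic_morph t k) o1 w) ==> allgood (initial_graph (basic_morph t k) o1 w) by rewrite ne.
case: w sw w0 {w1 ne} => [|x [|y [|//]]] // _ _.
- by case: Ht => [|[|[|]]] ->; case: (letter_cases x) => ->; vm_compute.
- by case: Ht => [|[|[|]]] ->; case: (letter_cases x) => ->; case: (letter_cases y) => ->; vm_compute.
Qed.

Lemma run_allgood x k (w : word) (g : graph) : g \in graphs -> x != o3 ->
  (forall a b, w != nseq (size w) o3 -> edge g a b -> a = o1) ->
  (w = nseq (size w) o3 -> forall a b, edge g a b = edge (run_graph x k (size w)) a b) ->
  nonempty g -> allgood g.
Proof.
move=> gin nx H1 H2; have [E|n] := eqVneq w (nseq (size w) o3).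
  rewrite (graph_eq gin (graph_of_graphs _) (H2 E)); exact: run_graph_allgood.
by move=> ne; apply: (star_left (a0 := o1)) => // a b; apply: H1.
Qed.

(** Among the words without marker, only the empty one constrains the centers. *)
Lemma ginit_allgood t k (w : word) : 0 < k -> o1 \notin w -> w != [::] ->
  nonempty (initial_graph (basic_morph t k) o1 w) -> allgood (initial_graph (basic_morph t k) o1 w).
Proof.
move=> k0 w1 w0; have [D1 D2 D3] := deltaE k; have [Z1 Z2 Z3] := zetaE k.
have I11 a b : infix (a :: rcons w b) [:: o1; o1] = false.
  apply/negP => /size_infix; rewrite /= size_rcons; by case: w w0 {w1}.
have I121 a b : infix (a :: rcons w b) [:: o1; o2; o1] -> a = o1 /\ w = [:: o2].
  move=> H; have := size_infix H; rewrite /= size_rcons !ltnS.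
  case: w w1 w0 H {I11} => [|x [|y w]] //= _ _ H _; move: H.
  by case: (letter_cases x) => ->; case: (letter_cases a) => ->; case: (letter_cases b) => ->.
have E2 (R : word) b : prefix (rcons w b) (o2 :: R) -> w != nseq (size w) o3.
  by case: w w0 {w1 I11 I121} => // c w _ /= /andP[/eqP -> _].
case: t; try by apply: short_allgood; tauto.
- apply: (@run_allgood o2 k w _ (graph_of_graphs _)) => //.
  + move=> a b /negbTE n; rewrite ginit_edge has_letters [basic_morph _ _]/= D1 D2 D3.
    rewrite !rcons_cons I11 !infix_cons2 /= !(nseq_rcons k) -![o3 :: nseq k o3]/(nseq k.+1 o3).
    rewrite !(prefix_run _ _ w1) !(infix_run _ _ _ w1) n /= !andbF !orbF.
    by case/orP=> /andP[/eqP].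
  + move=> E a b; rewrite ginit_edge has_letters [basic_morph _ _]/= D1 D2 D3.
    rewrite !rcons_cons I11 !infix_cons2 !prefix_cons !(nseq_rcons k) -![o3 :: nseq k o3]/(nseq k.+1 o3).
    have F (R : word) : prefix (rcons w b) (o2 :: R) = false.
      by apply/negP => /E2; rewrite {1}E eqxx.
    rewrite !F !andbF !(prefix_run _ _ w1) !(infix_run _ _ _ w1) !run_nextsP !(introT eqP E) edge_graph_of.
    rewrite /= !ltnS.
    by case: (letter_cases a) => ->; rewrite //= ?orbF //; case: (letter_cases b) => ->; rewrite /run_next /= ?orbF ?orFb ?andbT ?andbF //; move: (size w) => n; lia.
- apply: (@run_allgood o1 k w _ (graph_of_graphs _)) => //.
  + move=> a b /negbTE n; rewrite ginit_edge has_letters [basic_morph _ _]/= Z1 Z2 Z3.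
    have [/I121[]//|_] := boolP (infix (a :: rcons w b) (rcons [:: o1; o2] o1)).
    rewrite !rcons_cons !infix_cons2 !prefix_cons.
    rewrite !(nseq_rcons k) -![o3 :: nseq k o3]/(nseq k.+1 o3).
    by rewrite !(prefix_run _ _ w1) !(infix_run _ _ _ w1) n /= !andbF.
  + move=> E a b; rewrite ginit_edge has_letters [basic_morph _ _]/= Z1 Z2 Z3.
    have F : infix (a :: rcons w b) (rcons [:: o1; o2] o1) = false.
      by apply/negP => /I121[_ E']; move: E; rewrite E'.
    rewrite F !rcons_cons !infix_cons2 !prefix_cons !(nseq_rcons k) -![o3 :: nseq k o3]/(nseq k.+1 o3).
    rewrite !(prefix_run _ _ w1) !(infix_run _ _ _ w1) !run_nextsP !(introT eqP E) edge_graph_of.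
    rewrite /= !ltnS.
    by case: (letter_cases a) => ->; rewrite //= ?orbF //; case: (letter_cases b) => ->; rewrite /run_next /= ?orbF ?orFb ?andbT ?andbF //; move: (size w) => n; lia.
Qed.

(** * Transfer of good graphs through one basic morphism *)

Definition sound t l' r' l r : bool :=
  good l r (eps_graph t) &&
  all (fun g => if good l' r' g then
    all (fun la => all (fun ro =>
      let h := graph_image la ro g in if nonempty h then good l r h else true) (right_tables t)) (left_tables t)
    else true) graphs.

Lemma all_nth_tab (P : (letter -> letter -> bool) -> bool) s i :
  all P s -> i < size s -> P (nth idtab s i).
Proof. by elim: s i => //= x s IH [|i] /andP[H1 H2] //; exact: IH. Qed.

Lemma eq_graph_image la la' ro ro' g : la =2 la' -> ro =2 ro' -> graph_image la ro g = graph_image la' ro' g.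
Proof.
move=> E1 E2; apply: graph_eq; rewrite ?graph_of_graphs // => a b; rewrite !edge_graph_of.
by apply: eq_has => c; apply: eq_has => d; rewrite E1 E2.
Qed.

Lemma sound_step t k L' l' r' l r w : 0 < k -> extendable L' -> sound t l' r' l r ->
  nonempty (ext_graph (image_lang (basic_morph t k) L') w) ->
  (forall u, size u < size w -> L' u -> good l' r' (ext_graph L' u)) ->
  good l r (ext_graph (image_lang (basic_morph t k) L') w).
Proof.
move=> k0 okL' /andP[S1 S2] ne IH.
have fE := basic_morphE t k; have tlm := @basic_tail_notin t k; have inj := @basic_tail_inj t k.
have [m1|m1] := boolP (o1 \in w); last first.
  move: ne; rewrite (init_graph fE okL' m1).
  have [->|w0] := eqVneq w [::]; first by rewrite ginit_nil.
  by move=> ne; apply: allgood_good; apply: ginit_allgood.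
have [v [_ Iv]] : image_lang (basic_morph t k) L' w.
  move/nonemptyP: (ne) => [a [b /ext_graphP[u [Lu Iu]]]]; exists u; split=> //.
  apply: infix_trans Iu; rewrite -cats1 -cat1s; exact: infix_infix.
have [s [u [p [Ew ns np]]]] := parse fE tlm Iv m1.
move: ne; rewrite Ew (img_graph fE tlm inj okL') // => ne.
have Lu : L' u.
  by move/nonemptyP: ne => [a [b /graph_imageP[c [d [/ext_graphP/(ok_cons okL')/(ok_rcons okL') H _ _]]]]].
(* Images are nonempty and [w] contains one marker more than the image of [u], so desubstitution
   strictly shortens words: this is what makes an induction across levels well founded. *)
have su : size u < size w.
  rewrite Ew !size_cat /= !addnS ltnS; apply: leq_trans (size_mapply fE u) _.
  by rewrite addnCA leq_addr.
have gu := IH u su Lu.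
have [[a0 Ha0]|[i li Es]] := lam_nodes t s k0.
  apply/allgood_good/(star_left (a0 := a0)); rewrite ?graph_of_graphs // => a b.
  by move=> /graph_imageP[c [d [_ /Ha0]]].
have [[a0 Ha0]|[j lj Ep]] := rho_nodes t p k0.
  apply/allgood_good/(star_right (b0 := a0)); rewrite ?graph_of_graphs // => a b.
  by move=> /graph_imageP[c [d [_ _ /Ha0]]].
subst s p; move: ne; rewrite (eq_graph_image _ (lam_tab k0 li) (rho_tab k0 lj)) => ne.
have := allP S2 _ (ext_graph_in L' u); rewrite gu => /(all_nth_tab)/(_ li)/all_nth_tab/(_ lj) /=.
by rewrite ne.
Qed.

(** * Permutations of the alphabet *)

Definition perms : seq (seq letter) :=
  [:: [:: o1; o2; o3]; [:: o1; o3; o2]; [:: o2; o1; o3];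
      [:: o2; o3; o1]; [:: o3; o1; o2]; [:: o3; o2; o1]].

Definition perm_app (p : seq letter) (a : letter) : letter := nth o1 p a.
Definition perm_inv (p : seq letter) (a : letter) : letter := nth o1 letters (index a p).
Definition perm_morph (p : seq letter) : morph := fun a => [:: perm_app p a].

Lemma pappK p : p \in perms -> cancel (perm_app p) (perm_inv p).
Proof.
have H : all (fun p => all (fun a => perm_inv p (perm_app p a) == a) letters) perms by vm_compute.
by move/(allP H)/all_lettersP => E a; apply/eqP.
Qed.

Lemma pinvK p : p \in perms -> cancel (perm_inv p) (perm_app p).
Proof.
have H : all (fun p => all (fun a => perm_app p (perm_inv p a) == a) letters) perms by vm_compute.
by move/(allP H)/all_lettersP => E a; apply/eqP.
Qed.

Lemma mapply_pmor p w : mapply (perm_morph p) w = map (perm_app p) w.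
Proof. by elim: w => //= a w IH; rewrite mapply_cons IH. Qed.

Definition relabel (h : letter -> letter) (g : graph) : graph := graph_of (fun a b => edge g (h a) (h b)).

Lemma infix_map (h : letter -> letter) u v : infix u v -> infix (map h u) (map h v).
Proof. by case/infixP => [p [s ->]]; rewrite !map_cat; apply/infixP; eexists; eexists. Qed.

Lemma img_pmor p L w : p \in perms -> extendable L -> image_lang (perm_morph p) L w <-> L (map (perm_inv p) w).
Proof.
move=> Pp okL; split.
- move=> [u [Lu]]; rewrite mapply_pmor => /(infix_map (perm_inv p)).
  by rewrite (mapK (pappK Pp)) => /(ok_infix okL); apply.
- move=> H; exists (map (perm_inv p) w); split=> //.
  by rewrite mapply_pmor (mapK (pinvK Pp)) infix_refl.
Qed.

Lemma ok_img_pmor p L : p \in perms -> extendable L -> extendable (image_lang (perm_morph p) L).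
Proof.
move=> Pp okL; split.
- move=> u w H /(img_pmor _ Pp okL) Lw; apply/(img_pmor _ Pp okL).
  exact: (ok_infix okL (infix_map _ H) Lw).
- move=> w /(img_pmor _ Pp okL)/(ok_ext okL)[a [b H]]; exists (perm_app p a), (perm_app p b).
  by apply/(img_pmor _ Pp okL); rewrite /= map_rcons !(pappK Pp).
- by move=> a; apply/(img_pmor _ Pp okL); exact: (ok_letter okL).
Qed.

Lemma ext_graph_pmor p L w : p \in perms -> extendable L ->
  ext_graph (image_lang (perm_morph p) L) w = relabel (perm_inv p) (ext_graph L (map (perm_inv p) w)).
Proof.
move=> Pp okL; apply: graph_eq; rewrite ?graph_of_graphs // => a b; rewrite [RHS]edge_graph_of.
by apply/ext_graphP/ext_graphP => /=; rewrite -map_rcons -map_cons => /(img_pmor _ Pp okL).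
Qed.

Lemma good_relab p l r g : p \in perms -> g \in graphs -> good l r g ->
  good (perm_app p l) (perm_app p r) (relabel (perm_inv p) g).
Proof.
have H : all (fun g => if treeb g then all (fun p =>
     let h := relabel (perm_inv p) g in treeb h &&
     all (fun l => (lcenter l g ==> lcenter (perm_app p l) h) && (rcenter l g ==> rcenter (perm_app p l) h)) letters) perms
  else true) graphs by vm_compute.
move=> Pp gin /and3P[Tg Lg Rg]; have := allP H _ gin; rewrite Tg => /allP/(_ _ Pp)/andP[T2 /all_lettersP H2].
rewrite /good T2; have /andP[/implyP/(_ Lg)-> _] := H2 l.
by have /andP[_ /implyP/(_ Rg)->] := H2 r.
Qed.

(** * Labels of the edges *)

Definition centers_of (v : vtx) : letter * letter :=
  match v with V32 => (o3, o2) | V33 => (o3, o3) end.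

Definition q123 := [:: o1; o2; o3].
Definition q132 := [:: o1; o3; o2].
Definition q213 := [:: o2; o1; o3].
Definition q231 := [:: o2; o3; o1].
Definition q312 := [:: o3; o1; o2].
Definition q321 := [:: o3; o2; o1].

(** Syntactic labels without exponent: the infinite family of edges becomes a finite table on which
    checks can be computed. The entries of [arnoux] are the Arnoux-Rauzy morphisms, shared by both
    loops. *)
Definition edge_labels (u v : vtx) : seq (seq letter * kind * seq letter) :=
  let arnoux := [:: (q123, tA, q123); (q213, tA, q213); (q321, tA, q321)] in
  let zetas := [:: (q123, tZ, q213); (q213, tZ, q213); (q123, tZ, q231); (q213, tZ, q231)] in
  match u, v with
  | V32, V32 => arnoux ++
     [:: (q321, tB, q123); (q312, tB, q132); (q213, tG, q123); (q231, tG, q132);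
         (q213, tD, q123); (q213, tD, q132); (q132, tE, q123); (q132, tE, q231); (q132, tE, q321)]
  | V33, V33 => arnoux ++ zetas
  | V32, V33 =>
     [:: (q312, tB, q213); (q321, tB, q312); (q213, tG, q123); (q231, tG, q132);
         (q213, tD, q123); (q213, tD, q132); (q132, tE, q123)]
  | V33, V32 =>
     [:: (q312, tB, q213); (q321, tB, q213); (q312, tB, q312); (q321, tB, q312);
         (q312, tG, q231); (q321, tG, q231); (q312, tG, q321); (q321, tG, q321)] ++ zetas
  end.

Definition label_morph p t k q : morph := mcomp (perm_morph p) (mcomp (basic_morph t k) (perm_morph q)).

Lemma mcomp_eq f f' g g' : f =1 f' -> g =1 g' -> mcomp f g =1 mcomp f' g'.
Proof. by move=> E1 E2 a; rewrite /mcomp E2 (eq_mapply E1). Qed.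

Lemma mcompA f g h : mcomp (mcomp f g) h =1 mcomp f (mcomp g h).
Proof. by move=> a; rewrite /mcomp -mapply_comp. Qed.

Lemma mcomp1f f : mcomp (perm_morph q123) f =1 f.
Proof.
move=> a; rewrite /mcomp mapply_pmor -[RHS]map_id; apply: eq_map => b.
by case: (letter_cases b) => ->.
Qed.

Lemma mcompf1 f : mcomp f (perm_morph q123) =1 f.
Proof. by move=> a; rewrite /mcomp mapply1; case: (letter_cases a) => ->. Qed.

Lemma emor_s t k : label_morph q123 t k q123 =1 basic_morph t k.
Proof. by move=> a; rewrite /label_morph mcomp1f mcompf1. Qed.

Lemma emor_ps P p t k : p =1 perm_morph P -> label_morph P t k q123 =1 mcomp p (basic_morph t k).
Proof. by move=> E a; apply: mcomp_eq => b; rewrite ?E ?mcompf1. Qed.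

Lemma emor_sq Q q t k : q =1 perm_morph Q -> label_morph q123 t k Q =1 mcomp (basic_morph t k) q.
Proof. by move=> E a; rewrite /label_morph mcomp1f; apply: mcomp_eq => b; rewrite ?E. Qed.

Lemma emor_psq P Q p q t k : p =1 perm_morph P -> q =1 perm_morph Q ->
  label_morph P t k Q =1 mcomp (mcomp p (basic_morph t k)) q.
Proof. by move=> E1 E2 a; rewrite mcompA; apply: mcomp_eq => b; rewrite ?E1 //; apply: mcomp_eq => c. Qed.

Lemma perm3E a b c : perm3 a b c =1 perm_morph [:: a; b; c].
Proof. by move=> x; case: (letter_cases x) => ->. Qed.

Ltac typ_of s := match s with
  | alpha => constr:((tA, 1)) | beta => constr:((tB, 1)) | gamma => constr:((tG, 1))
  | eta => constr:((tE, 1)) | delta ?k => constr:((tD, k)) | zeta ?k => constr:((tZ, k)) end.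

Ltac emor_of X := match X with
  | mcomp (mcomp (perm3 ?a ?b ?c) ?s) (perm3 ?a' ?b' ?c') =>
     let t := typ_of s in constr:(([:: a; b; c], t, [:: a'; b'; c']))
  | mcomp (perm3 ?a ?b ?c) ?s => let t := typ_of s in constr:(([:: a; b; c], t, q123))
  | mcomp ?s (perm3 ?a' ?b' ?c') => let t := typ_of s in constr:((q123, t, [:: a'; b'; c']))
  | ?s => let t := typ_of s in constr:((q123, t, q123)) end.

Ltac emor_eq := first [ exact: emor_s | exact: (emor_psq _ _ (perm3E _ _ _) (perm3E _ _ _)) 
  | exact: (emor_ps _ _ (perm3E _ _ _)) | exact: (emor_sq _ _ (perm3E _ _ _)) ].

Ltac unfold_perms := rewrite /p123 /p132 /p213 /p231 /p312 /p321.

Ltac find_edge := match goal with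
  | H : _ =1 ?X |- _ => let e := emor_of X in
     match e with (?P, (?t, ?k), ?Q) =>
       exists P, t, Q, k; split; [by rewrite /=; tauto | by [] |
         let a := fresh in move=> a; rewrite H; symmetry; move: a; emor_eq] end
  end.

Ltac pick_edge := first [
   match goal with H : ?m =1 label_morph _ _ ?k _ |- exists k', _ => exists k; split; [by [] | pick_edge] end
 | match goal with H : ?m =1 label_morph ?P ?t ?k ?Q |- ?m =1 ?X =>
     let a := fresh in move=> a; rewrite H; move: a; emor_eq end
 | left; pick_edge | right; pick_edge ].

Lemma G_edgeP u m v : G_edge u m v <-> exists p t q k,
  [/\ List.In (p, t, q) (edge_labels u v), 0 < k & m =1 label_morph p t k q].
Proof.
split.
- case: u; case: v; rewrite /G_edge /loop32 /loop33 /edge32_33 /edge33_32; unfold_perms;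
  intros H;
  repeat (match goal with
    | H : _ \/ _ |- _ => destruct H as [H|H]
    | H : exists k, _ |- _ => destruct H as [k [? H]]
    end); find_edge.
- move=> [p [t [q [k [H k0 E]]]]]; move: E.
  case: u H; case: v; rewrite /G_edge /loop32 /loop33 /edge32_33 /edge33_32 /edge_labels /=; unfold_perms;
  intros H E;
  repeat (match goal with
    | H : _ \/ _ |- _ => destruct H as [H|H]
    end); try (by []); injection H as <- <- <-; pick_edge.
Qed.

(** * Soundness of an edge *)

Lemma infix_neighbours (a b : letter) x y (z1 w z2 : word) :
  exists a' b', infix (a' :: rcons w b') (rcons x a ++ (z1 ++ w ++ z2) ++ b :: y).
Proof.
have [x' [a' Ex]] : exists x' a', rcons x a ++ z1 = rcons x' a'.
  by case/lastP: z1 => [|z1 c]; [exists x, a; rewrite cats0 | exists (rcons x a ++ z1), c; rewrite -rcons_cat].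
have [y' [b' Ey]] : exists y' b', z2 ++ b :: y = b' :: y'.
  by case: z2 => [|c z2]; [exists y, b | exists (z2 ++ b :: y), c].
exists a', b'; apply/infixP; exists x', y'.
by rewrite -!catA Ey (catA _ z1) Ex cat_rcons /= cat_rcons.
Qed.

Lemma extendable_image (f : morph) L : (forall c, f c != [::]) -> (forall a, exists c, a \in f c) ->
  extendable L -> extendable (image_lang f L).
Proof.
move=> f0 fl okL; split.
- by move=> u w H [v [Lv Iv]]; exists v; split=> //; exact: infix_trans H Iv.
- move=> w [v [/(ok_ext okL)[c [d H]] /infixP[z1 [z2 E]]]].
  have [x [a E1]] : exists x a, f c = rcons x a.
    by case/lastP: (f c) (f0 c) => [//|x a] _; exists x, a.
  have [b [y E2]] : exists b y, f d = b :: y.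
    by case: (f d) (f0 d) => [//|b y] _; exists b, y.
  have [a' [b' I]] := infix_neighbours a b x y z1 w z2.
  exists a', b', (c :: rcons v d); split=> //.
  by rewrite mapply_cons -(cats1 v d) mapply_cat mapply1 E1 E2 E.
- by move=> a; have [c Hc] := fl a; exists [:: c]; rewrite mapply1 infix1s; split=> //; exact: ok_letter.
Qed.

Lemma smorph_letters t k a : 0 < k -> exists c, a \in basic_morph t k c.
Proof.
case: k => // k _.
case: (letter_cases a) => ->; [exists o1 | exists o2 | exists o3]; by case: t; rewrite //= !inE.
Qed.

Lemma ok_img_smorph t k L : 0 < k -> extendable L -> extendable (image_lang (basic_morph t k) L).
Proof.
by move=> k0; apply: extendable_image => [c|a]; [rewrite basic_morphE | exact: smorph_letters].
Qed.

Definition vtxs := [:: V32; V33].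

(** [sound] concerns the bare morphism: on the source side the centers of [v] are seen through [q],
    on the target side those of [u] through the inverse of [p]. *)
Lemma sound_edges : all (fun u => all (fun v => all (fun e : seq letter * kind * seq letter =>
   let: (p, t, q) := e in [&& p \in perms, q \in perms &
   sound t (perm_app q (centers_of v).1) (perm_app q (centers_of v).2) (perm_inv p (centers_of u).1) (perm_inv p (centers_of u).2)])
   (edge_labels u v)) vtxs) vtxs.
Proof. by vm_compute. Qed.

Lemma all_In T (P : T -> bool) s x : all P s -> List.In x s -> P x.
Proof. by elim: s => //= y s IH /andP[H1 H2] [<-|/IH]; auto. Qed.

Lemma has_In T (P : T -> bool) s : has P s -> exists x, List.In x s /\ P x.
Proof.
elim: s => //= y s IH /orP[H|/IH[x [H1 H2]]]; first by exists y; auto.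
by exists x; auto.
Qed.

Lemma vtxs_In v : List.In v vtxs.
Proof. by case: v => /=; tauto. Qed.

Lemma good_pmor p l r L w : p \in perms -> extendable L -> good l r (ext_graph L w) ->
  good (perm_app p l) (perm_app p r) (ext_graph (image_lang (perm_morph p) L) (map (perm_app p) w)).
Proof.
move=> Pp okL H; rewrite ext_graph_pmor // (mapK (pappK Pp)).
by apply: good_relab => //; exact: ext_graph_in.
Qed.

Lemma sound_edge u m v L w : G_edge u m v -> extendable L -> image_lang m L w ->
  (forall x, size x < size w -> L x -> good (centers_of v).1 (centers_of v).2 (ext_graph L x)) ->
  good (centers_of u).1 (centers_of u).2 (ext_graph (image_lang m L) w).
Proof.
move=> /G_edgeP[p [t [q [k [He k0 Em]]]]] okL; rewrite (eq_img _ Em) !img_comp => Iw IH.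
have /and3P[Pp Pq S] := all_In (all_In (all_In sound_edges (vtxs_In u)) (vtxs_In v)) He.
have okq : extendable (image_lang (perm_morph q) L) by exact: ok_img_pmor.
have oks : extendable (image_lang (basic_morph t k) (image_lang (perm_morph q) L)) by exact: ok_img_smorph.
move/(img_pmor _ Pp oks): Iw => Iw.
rewrite -(mapK (pinvK Pp) w) -(pinvK Pp (centers_of u).1) -(pinvK Pp (centers_of u).2).
apply: good_pmor => //; apply: sound_step S _ _ => //; first exact: ext_nonempty.
move=> x; rewrite size_map => sx /(img_pmor _ Pq okL) Lx.
rewrite -(mapK (pinvK Pq) x); apply: good_pmor => //.
by apply: IH => //; rewrite size_map.
Qed.

(** * Centers *)

Definition tree_lang (L : language) := forall w, L w -> treeb (ext_graph L w).

Lemma treeb_no_cycle4 g : g \in graphs -> treeb g -> no_cycle4 g.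
Proof. by move=> gin; rewrite treebE // => /and3P[]. Qed.

Lemma common_prefix (u v : word) : size u < size v ->
  (exists b v', v = u ++ b :: v') \/
  exists w x y u' v', [/\ u = w ++ x :: u', v = w ++ y :: v' & x != y].
Proof.
elim: u v => [|c u IH] [|d v] //=; first by left; exists d, v.
rewrite ltnS => /IH H; have [<-|n] := eqVneq c d; last first.
  by right; exists [::], c, d, u, v.
case: H => [[b [v' ->]]|[w [x [y [u' [v' [-> -> n]]]]]]]; first by left; exists b, v'.
by right; exists (c :: w), x, y, u', v'.
Qed.

Lemma long_share L c d u v : extendable L -> tree_lang L -> c != d ->
  L (c :: v) -> L (d :: v) -> size u < size v -> share_left c d (ext_graph L u).
Proof.
move=> okL tL n Lc Ld /common_prefix H; apply/implyP => /(lvP okL) Hc; apply/implyP => /(lvP okL) Hd.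
apply/has_lettersP; case: H => [[b [v' E]]|[w [x [y [u' [v' [Eu Ev nx]]]]]]].
  exists b; apply/andP; split; apply/ext_graphP; [move: Lc | move: Ld]; rewrite E -cat_rcons -cat_cons; exact: ok_catl.
exfalso; have cut e z r : L (e :: w ++ z :: r) -> L (e :: rcons w z).
  by rewrite -cat_rcons -cat_cons; exact: ok_catl.
rewrite Eu in Hc Hd; rewrite Ev in Lc Ld.
have Lw : L w by have := ok_cons okL (ok_catl okL (u := c :: w) Hc).
have := treeb_no_cycle4 (ext_graph_in L w) (tL w Lw); apply/negP/cyc4P.
exists c, x, d, y; split; rewrite 1?eq_sym //; try apply/ext_graphP; try (apply/andP; split; apply/ext_graphP).
- exact: cut Hc.
- exact: cut Hd.
- exact: cut Lc.
- exact: cut Ld.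
Qed.

(** By connectedness a path leaving [c] meets another left vertex after two edges. A word extended
    on the left by [c] and another letter can thus be prolonged to the right so as to keep [c] and
    some second left extension, possibly a different one. *)
Lemma tree_link g c d : g \in graphs -> treeb g -> lvertex g c -> lvertex g d -> c != d ->
  exists d' b, [/\ d' != c, edge g c b & edge g d' b].
Proof.
have H : all (fun g => if treeb g then all (fun c => all (fun d =>
   [&& lvertex g c, lvertex g d & c != d] ==> has (fun d' => has (fun b => [&& d' != c, edge g c b & edge g d' b]) letters) letters)
   letters) letters else true) graphs by vm_compute.
move=> gin Tg Hc Hd n; have := allP H _ gin; rewrite Tg => /all_lettersP/(_ c)/all_lettersP/(_ d).
move/implyP/(_ (introT and3P (And3 Hc Hd n))).
by case/has_lettersP=> d' /has_lettersP[b /and3P[E1 E2 E3]]; exists d', b.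
Qed.

Lemma other_letters (c : letter) : exists d1 d2, [/\ d1 != c, d2 != c, d1 != d2 & forall d, d != c -> d = d1 \/ d = d2].
Proof.
case: (letter_cases c) => ->; [exists o2, o3 | exists o1, o3 | exists o1, o2]; split=> // d;
  by case: (letter_cases d) => ->; auto.
Qed.

(* Along arbitrarily long words v with cv in L, some d <> c satisfies dv in L; if this d failed to share with c at u, then u and v would branch at a common prefix, creating a 4-cycle there. *)
Lemma center_left L c : extendable L -> tree_lang L ->
  exists2 d, d != c & forall w, L w -> share_left c d (ext_graph L w).
Proof.
move=> okL tL.
have V n : exists v d, [/\ size v = n, d != c, L (c :: v) & L (d :: v)].
  elim: n => [|n [v [d [sv nd Lc Ld]]]].
    have [d [_ [nd _ _ _]]] := other_letters c.
    by exists [::], d; split=> //; exact: ok_letter.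
  have gc := introT (lvP okL v c) Lc; have gd := introT (lvP okL v d) Ld.
  rewrite eq_sym in nd.
  have [d' [b [nd' /ext_graphP E1 /ext_graphP E2]]] :=
    tree_link (ext_graph_in L v) (tL v (ok_cons okL Lc)) gc gd nd.
  by exists (rcons v b), d'; rewrite size_rcons sv.
apply: NNPP => H; have bad d : d != c -> exists u, L u /\ ~~ share_left c d (ext_graph L u).
  move=> nd; apply: NNPP => H1; apply: H; exists d => // w Lw.
  by apply/negPn/negP => H2; apply: H1; exists w.
have [d1 [d2 [n1 n2 _ D]]] := other_letters c.
have [u1 [Lu1 /negP B1]] := bad _ n1; have [u2 [Lu2 /negP B2]] := bad _ n2.
have [v [d [sv nd Lc Ld]]] := V (size u1 + size u2).+1.
case: (D _ nd) => Ed; subst d; rewrite eq_sym in nd; [apply: B1 | apply: B2];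
  apply: (long_share (v := v)) => //; rewrite sv ltnS ?leq_addr ?leq_addl //.
Qed.

Definition mirror (L : language) : language := fun w => L (rev w).
Definition transpose (g : graph) : graph := graph_of (fun a b => edge g b a).

Lemma mirror_extendable L : extendable L -> extendable (mirror L).
Proof.
move=> okL; split.
- by move=> u w H; apply: (ok_infix okL); rewrite infix_rev.
- move=> w /(ok_ext okL)[a [b H]]; exists b, a.
  by rewrite /mirror rev_cons rev_rcons.
- by move=> a; exact: (ok_letter okL).
Qed.

Lemma mirror_graph L w : ext_graph (mirror L) w = transpose (ext_graph L (rev w)).
Proof.
apply: graph_eq; rewrite ?graph_of_graphs // => a b; rewrite [RHS]edge_graph_of.
by apply/ext_graphP/ext_graphP; rewrite /mirror rev_cons rev_rcons.
Qed.

Lemma transpose_props g : g \in graphs ->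
  treeb (transpose g) = treeb g /\ forall a b, share_left a b (transpose g) = share_right a b g.
Proof.
have H : all (fun g => let h := transpose g in (treeb h == treeb g) &&
  all (fun a => all (fun b => share_left a b h == share_right a b g) letters) letters) graphs by vm_compute.
move/(allP H)/andP=> [/eqP H1 /all_lettersP H2]; split; first exact: H1.
by move=> a b; have /all_lettersP/(_ b)/eqP H3 := H2 a; exact: H3.
Qed.

Lemma center_right L c : extendable L -> tree_lang L ->
  exists2 d, d != c & forall w, L w -> share_right c d (ext_graph L w).
Proof.
move=> okL tL; have [|d nd H] := @center_left (mirror L) c (mirror_extendable okL).
  by move=> w Lw; rewrite mirror_graph (proj1 (transpose_props _)) ?ext_graph_in //; exact: tL.
exists d => // w Lw; have := H (rev w); rewrite mirror_graph /mirror revK => /(_ Lw).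
by rewrite (proj2 (transpose_props (ext_graph_in L w))).
Qed.

Lemma shl_sym a b g : share_left a b g = share_left b a g.
Proof.
rewrite /share_left; case: (lvertex g a); case: (lvertex g b) => //=; congr orb; rewrite andbC //.
by congr orb; rewrite andbC //; congr orb; rewrite andbC.
Qed.

Lemma shr_sym a b g : share_right a b g = share_right b a g.
Proof.
rewrite /share_right; case: (rvertex g a); case: (rvertex g b) => //=; congr orb; rewrite andbC //.
by congr orb; rewrite andbC //; congr orb; rewrite andbC.
Qed.

Lemma shl_refl a g : share_left a a g.
Proof.
apply/implyP => /has_lettersP[b E]; apply/implyP => _.
by apply/has_lettersP; exists b; rewrite E.
Qed.

Lemma shr_refl a g : share_right a a g.
Proof.
apply/implyP => /has_lettersP[b E]; apply/implyP => _.
by apply/has_lettersP; exists b; rewrite E.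
Qed.

Definition lshare L a b := forall w, L w -> share_left a b (ext_graph L w).
Definition rshare L a b := forall w, L w -> share_right a b (ext_graph L w).

(** The third letter [e] has a partner, necessarily [a] or [b]; that partner shares with [e] and
    with the other letter of the pair, hence with all. Which of the two it is stays out of
    control. *)
Lemma center_of_pair (S : letter -> letter -> Prop) a b :
  (forall x y, S x y -> S y x) -> (forall x, S x x) ->
  (forall c, exists2 d, d != c & S c d) -> a != b -> S a b ->
  exists2 l, l = a \/ l = b & forall x, S l x.
Proof.
move=> sym rfl H n Sab.
have [e [na nb]] : exists e, e != a /\ e != b.
  have [d1 [d2 [n1 n2 n12 D]]] := other_letters a; rewrite eq_sym in n; case: (D b n) => ->.
    by exists d2; split=> //; rewrite eq_sym.
  by exists d1.
have tri x : [\/ x = a, x = b | x = e].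
  move: n na nb; case: (letter_cases a) => ->; case: (letter_cases b) => ->; case: (letter_cases e) => -> //;
  by case: (letter_cases x) => ->; rewrite //= => _ _ _; constructor.
have [f nf Sef] := H e; case: (tri f) => Ef; subst f; last by rewrite eqxx in nf.
- by exists a; [left | move=> x; case: (tri x) => ->; auto].
- by exists b; [right | move=> x; case: (tri x) => ->; auto].
Qed.

(** * Canonical forms and return words *)

(** Strong connectivity of the directed graph on letters with arrows [a -> b]: every proper nonempty
    set of letters has an outgoing arrow. *)
Definition irreducible_graph (g : graph) : bool :=
  all (fun S => if has (bit S) letters && ~~ all (bit S) letters then
    has (fun a => bit S a && has (fun b => ~~ bit S b && edge g a b) letters) letters else true) (bitstrings 3).

Lemma adjacent_ok L a b w1 w2 : extendable L -> L (w1 ++ a :: b :: w2) -> edge (ext_graph L [::]) a b.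
Proof.
move=> okL /(ok_catr okL); rewrite -[a :: b :: w2]/([:: a; b] ++ w2) => /(ok_catl okL) H.
by apply/ext_graphP.
Qed.

(** Words starting in a set of letters without outgoing arrow never leave it, so a letter outside
    the set would be missing from arbitrarily long words. *)
Lemma unif_rec_irreducible L : extendable L -> unif_rec L -> irreducible_graph (ext_graph L [::]).
Proof.
move=> okL UR; apply/allP => S _; case: ifP => // /andP[/has_lettersP[a Sa] /allPn[b _ Sb]].
apply/negPn/negP => H.
have cl c d w1 w2 : L (w1 ++ c :: d :: w2) -> bit S c -> bit S d.
  move=> /(adjacent_ok okL) E Sc; apply/negPn/negP => Sd; case/negP: H.
  by apply/has_lettersP; exists c; rewrite Sc; apply/has_lettersP; exists d; rewrite Sd.
have st w c : L (c :: w) -> bit S c -> all (bit S) (c :: w).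
  elim: w c => [|d w IH] c Lw Sc /=; first by rewrite Sc.
  by rewrite Sc /=; apply: IH; [exact: ok_cons Lw | exact: (cl c d [::] w)].
have [N HN] := UR [:: b] (ok_letter okL b).
have [x [y [sx sy Lxy]]] := ok_extn okL N (ok_letter okL a).
have Lay := ok_catr okL Lxy; rewrite /= in Lay.
have Hb : b \in a :: y by rewrite -infix1s; apply: HN Lay _; rewrite /= sy.
by have /allP/(_ b Hb) := st _ _ Lay Sa; rewrite (negbTE Sb).
Qed.

(** The origin of the six kinds: relabelling both sides by the same permutation, these are the only
    strongly connected trees using all six vertices. *)
Lemma canon_check : all (fun g => if treeb g then
    if all (fun a => lvertex g a && rvertex g a) letters && irreducible_graph g then
    has (fun p => has (fun t => relabel (perm_inv p) g == eps_graph t) kinds) perms else true else true) graphs.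
Proof. by vm_compute. Qed.

Lemma canonical_form L : extendable L -> unif_rec L -> treeb (ext_graph L [::]) ->
  exists p t, p \in perms /\ ext_graph (image_lang (perm_morph p) L) [::] = eps_graph t.
Proof.
move=> okL UR Tg; have := allP canon_check _ (ext_graph_in L [::]).
rewrite Tg unif_rec_irreducible // andbT.
have -> : all (fun a => lvertex (ext_graph L [::]) a && rvertex (ext_graph L [::]) a) letters.
  by apply/all_lettersP => a; apply/andP; split; [apply/(lvP okL) | apply/(rvP okL)]; exact: ok_letter.
move=> /hasP[p Pp /has_In[t [_ /eqP E]]]; exists p, t; split=> //.
by rewrite ext_graph_pmor.
Qed.

(** * Lengths of the runs of the letter 3 *)

Section Runs.
Variables (M : language) (x : letter).
Hypotheses (okM : extendable M) (tM : tree_lang M) (URM : unif_rec M) (nx : x != o3).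
Hypothesis pred3 : forall a w, M (a :: o3 :: w) -> a = x \/ a = o3.
Hypothesis succ3 : forall b w, M (rcons (rcons w o3) b) -> b = o3 \/ b = o1.
Hypothesis M33 : M [:: o3; o3].

(** Meant for a run one shorter than the maximum, where left 3 and right 3 are not adjacent. The
    edges from [x] to 3 and from 3 to 1 can then be connected only through the edge from [x] to
    1. *)
Lemma run_check : all (fun g => if treeb g then
  if [&& edge g x o3, edge g o3 o1, ~~ edge g o3 o3 & all (fun a => all (fun b => edge g a b ==>
      ((a == x) || (a == o3)) && ((b == o1) || (b == o3))) letters) letters]
  then edge g x o1 else true else true) graphs.
Proof. by move: nx; case: (letter_cases x) => ->; vm_compute. Qed.

Lemma rcons_run n : rcons (nseq n o3) o3 = nseq n.+1 o3.
Proof. exact: nseq_rcons. Qed.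

(* With K the maximal length of a run of 3s, the trees at 3^i force x 3^i 1 to occur exactly for i = K - 1 and i = K. *)
Lemma runs : exists2 k, 0 < k & forall j, 0 < j ->
  M (x :: rcons (nseq j o3) o1) <-> j = k \/ j = k.+1.
Proof.
have mono i j : i <= j -> M (nseq j o3) -> M (nseq i o3).
  by move=> /subnKC <-; rewrite nseqD; exact: ok_catl.
have [N HN] := URM (ok_letter okM o1).
have bound i : asbool (M (nseq i o3)) -> i <= N.
  move/asboolP => Mi; rewrite leqNgt; apply/negP => li.
  by have := HN _ Mi; rewrite size_nseq (ltnW li) infix1s mem_nseq andbF => /(_ isT).
have ex : exists i, asbool (M (nseq i o3)) by exists 2; apply/asboolP.
case: (ex_maxnP ex bound) => K /asboolP MK maxK.
have K2 : 2 <= K by apply: maxK; apply/asboolP.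
have noK i : K < i -> ~ M (nseq i o3).
  by move=> li Mi; have := maxK i (introT (asboolP _) Mi); rewrite leqNgt li.
have [a [b Mab]] := ok_ext okM MK.
have [n En] : exists n, K = n.+2 by exists K.-2; case: (K) K2 => [|[|]].
have Ea : a = x.
  have [//|Ea] : a = x \/ a = o3.
    by apply: (pred3 (w := rcons (nseq n.+1 o3) b)); move: Mab; rewrite En.
  by case: (noK K.+1) => //; move: Mab; rewrite Ea -rcons_cons => /(ok_rcons okM).
have Eb : b = o1.
  have [Eb|//] : b = o3 \/ b = o1.
    apply: (succ3 (w := a :: nseq n.+1 o3)); move: Mab.
    by rewrite En -rcons_run -!rcons_cons.
  by case: (noK K.+1) => //; move: Mab; rewrite Eb rcons_run => /(ok_cons okM).
subst a b.
have Mx j : j <= K -> M (x :: nseq j o3).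
  move=> /subnKC Ej; move: Mab; rewrite -rcons_cons => /(ok_rcons okM).
  by rewrite -Ej nseqD -cat_cons; exact: ok_catl.
have M1 j : j <= K -> M (rcons (nseq j o3) o1).
  move=> /subnK Ej; move: Mab => /(ok_cons okM).
  by rewrite -Ej nseqD rcons_cat; exact: ok_catr.
have G i := ext_graphP M (nseq i o3).
have Ex3 i : i < K -> edge (ext_graph M (nseq i o3)) x o3.
  by move=> li; apply/G; rewrite rcons_run; exact: Mx.
have E31 i : i < K -> edge (ext_graph M (nseq i o3)) o3 o1.
  by move=> li; apply/G; exact: (M1 i.+1).
exists n.+1 => // j j0; rewrite -En; split.
- move=> Mj; have jK : j <= K.
    by apply: maxK; apply/asboolP; exact: ok_rcons (ok_cons okM Mj).
  move: jK; rewrite En leq_eqVlt ltnS leq_eqVlt => /orP[/eqP|/orP[/eqP|]]; auto.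
  (* For [j <= K - 2] two more letters 3 still fit, so left 3 and right 3 are adjacent at the run of
     length [j], and an edge from [x] to 1 would close a cycle of length 4. *)
  rewrite ltnS => jn; exfalso.
  have Tj := tM (mono j K (leq_trans jn _) MK); rewrite En in Tj.
  have := treeb_no_cycle4 (ext_graph_in _ _) (Tj (leqW (leqnSn n))); apply/negP/cyc4P.
  have jK : j < K by rewrite En ltnS; exact: leqW.
  exists x, o3, o3, o1; split=> //; rewrite 1?eq_sym //; [exact: Ex3 | | ].
  + by apply/G; rewrite rcons_run; apply: (mono j.+2 K); rewrite // En !ltnS.
  + by rewrite E31 // andbT; apply/G.
- case=> [->|->//]; apply/G.
  have := allP run_check _ (ext_graph_in M (nseq n.+1 o3)).
  rewrite (tM (mono n.+1 K _ MK)) ?En ?leqnSn // Ex3 ?En // E31 ?En //.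
  case: ifP => // /negP[]; apply/and4P; split=> //.
    by apply/negP => /(elimT (G _ _ _)); rewrite rcons_run; apply: (noK n.+3); rewrite En.
  apply/all_lettersP => a; apply/all_lettersP => b; apply/implyP => /(elimT (G _ _ _)) H.
  apply/andP; split.
    by have [->|->] := pred3 (w := rcons (nseq n o3) b) H; rewrite eqxx ?orbT.
  have [->|->] : b = o3 \/ b = o1; rewrite ?eqxx ?orbT //.
  by apply: (succ3 (w := a :: nseq n o3)); rewrite rcons_cons rcons_run.
Qed.

End Runs.

Section Returns.
Variables (M : language) (t : kind).
Hypotheses (okM : extendable M) (tM : tree_lang M) (URM : unif_rec M).
Hypothesis epsM : ext_graph M [::] = eps_graph t.

Lemma eps_edge a b w1 w2 : M (w1 ++ a :: b :: w2) -> edge (eps_graph t) a b.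
Proof. by move=> H; rewrite -epsM; exact: adjacent_ok H. Qed.

Lemma edge_eps a b : edge (eps_graph t) a b -> M [:: a; b].
Proof. by rewrite -epsM => /ext_graphP. Qed.

Lemma force_right w b c : M (rcons w b) -> (forall d, edge (eps_graph t) b d -> d = c) -> M (rcons (rcons w b) c).
Proof.
move=> /(ok_extr okM)[d H] D; move: (H); rewrite -cats1 cat_rcons => /eps_edge/D E.
by rewrite -E.
Qed.

Lemma force_left a c w : M (a :: w) -> (forall d, edge (eps_graph t) d a -> d = c) -> M (c :: a :: w).
Proof.
move=> /(ok_extl okM)[d H] D; have /D E := eps_edge (w1 := [::]) H.
by rewrite -E.
Qed.

(** The return words to 1 in [M] are exactly the images of the three letters. *)
Definition return_coding (k : nat) : Prop :=
  0 < k /\ (forall z, o1 \notin z -> M (o1 :: rcons z o1) -> exists c, o1 :: z = basic_morph t k c) /\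
  (forall c, M (rcons (basic_morph t k c) o1)).

Ltac letter3 a := case: (letter_cases a) => ->.
Ltac det := let d := fresh in move=> d; letter3 d; by vm_compute.

(** In these four graphs the arrows between 2 and 3 form no cycle, so a return word has at most
    three letters. The loop at 3 in the two remaining graphs is what calls for an exponent. *)
Lemma short_returns : (t = tA \/ t = tB \/ t = tG \/ t = tE) -> return_coding 1.
Proof.
move=> Ht; split=> //; split.
- move=> z nz Mz.
  have E : forall w1 a b w2, o1 :: rcons z o1 = w1 ++ a :: b :: w2 -> edge (eps_graph t) a b.
    by move=> w1 a b w2 E; apply: (@eps_edge a b w1 w2); rewrite -E.
  case: z nz Mz E => [|a [|b [|c z]]] nz Mz E.
  + have := E [::] _ _ _ erefl; case: Ht => [|[|[|]]] -> //; by exists o1.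
  + have := E [::] _ _ _ erefl; have := E [:: o1] _ _ _ erefl; move: nz.
    case: Ht => [|[|[|]]] ->; letter3 a => // _ _ _; first [by exists o1 | by exists o2 | by exists o3].
  + have := E [::] _ _ _ erefl; have := E [:: o1] _ _ _ erefl; have := E [:: o1; a] _ _ _ erefl; move: nz.
    case: Ht => [|[|[|]]] ->; letter3 a; letter3 b => // _ _ _ _; first [by exists o1 | by exists o2 | by exists o3].
  + exfalso; have := E [:: o1] _ _ _ erefl; have := E [:: o1; a] _ _ _ erefl; move: nz.
    by case: Ht => [|[|[|]]] ->; letter3 a; letter3 b; letter3 c.
- have R b c w : M (rcons w b) -> (forall d, edge (eps_graph t) b d -> d = c) -> M (rcons (rcons w b) c) := @force_right w b c.
  have Lf a c w : M (a :: w) -> (forall d, edge (eps_graph t) d a -> d = c) -> M (c :: a :: w) := @force_left a c w.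
  have A a b : edge (eps_graph t) a b -> M [:: a; b] := @edge_eps a b.
  move: R Lf A; case: Ht => [|[|[|]]] -> R Lf A c; letter3 c.
  + exact: A.
  + by apply: (R o2 o1 [:: o1]); [exact: A | det].
  + by apply: (R o3 o1 [:: o1]); [exact: A | det].
  + exact: A.
  + by apply: (R o2 o1 [:: o1]); [exact: A | det].
  + by apply: (R o2 o1 [:: o1; o3]); [apply: (R o3 o2 [:: o1]); [exact: A | det] | det].
  + exact: A.
  + by apply: (Lf o2 o1 [:: o1]); [exact: A | det].
  + by apply: (R o3 o1 [:: o1; o2]); [apply: (Lf o2 o1 [:: o3]); [exact: A | det] | det].
  + by apply: (R o3 o1 [:: o1]); [exact: A | det].
  + by apply: (Lf o2 o1 [:: o1]); [exact: A | det].
  + by apply: (R o3 o1 [:: o1; o2]); [apply: (Lf o2 o1 [:: o3]); [exact: A | det] | det].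
Qed.

Lemma run_word w : (forall b, edge (eps_graph t) o3 b -> b != o2) -> o1 \notin w -> M (o3 :: w) -> w = nseq (size w) o3.
Proof.
move=> H; elim: w => // a w IH; rewrite inE negb_or => /andP[n1 nw] Mw.
have /H n2 := eps_edge (w1 := [::]) Mw.
have E : a = o3 by move: n1 n2; letter3 a.
by rewrite E /= {1}IH //; move: Mw; rewrite E => /(ok_cons okM).
Qed.

Lemma delta_returns : t = tD -> exists k, return_coding k.
Proof.
move=> Et.
have p3 a w : M (a :: o3 :: w) -> a = o2 \/ a = o3.
  by move=> /(eps_edge (w1 := [::])); rewrite Et; letter3 a; auto.
have s3 b w : M (rcons (rcons w o3) b) -> b = o3 \/ b = o1.
  by rewrite -cats1 cat_rcons => /eps_edge; rewrite Et; letter3 b; auto.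
have M33 : M [:: o3; o3] by apply: edge_eps; rewrite Et.
have [k k0 R] := runs okM tM URM (isT : o2 != o3) p3 s3 M33.
have [D1 D2 D3] := deltaE k.
exists k; split=> //; split.
- case=> [|a z] nz Mz; first by exists o1; rewrite Et.
  have Ea : a = o2.
    by move: nz; have := eps_edge (w1 := [::]) Mz; rewrite Et; letter3 a.
  subst a; case: z nz Mz => [|b z] nz Mz.
    by have := eps_edge (w1 := [:: o1]) Mz; rewrite Et.
  have Eb : b = o3 by have := eps_edge (w1 := [:: o1]) Mz; rewrite Et; letter3 b.
  subst b; have nz' : o1 \notin z by apply: contra nz; rewrite !inE => ->; rewrite !orbT.
  have Ez : o3 :: z = nseq (size z).+1 o3.
    rewrite {1}(@run_word z) //; first by rewrite Et => b; letter3 b.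
    have := ok_cons okM (ok_cons okM Mz); rewrite -rcons_cons; exact: ok_rcons.
  have /R[//|E|E] : M (o2 :: rcons (nseq (size z).+1 o3) o1) by rewrite -Ez; exact: (ok_cons okM Mz).
  + by exists o2; rewrite Et /= D2 Ez E.
  + by exists o3; rewrite Et /= D3 Ez E nseq_rcons.
- move=> c; rewrite Et; letter3 c; rewrite /= ?D1 ?D2 ?D3 /=.
  + by apply: edge_eps; rewrite Et.
  + apply: force_left; first by apply/R; auto.
    by rewrite Et; det.
  + apply: force_left; first by rewrite ?rcons_run; apply/(R k.+1); auto.
    by rewrite Et; det.
Qed.

Lemma zeta_returns : t = tZ -> exists k, return_coding k.
Proof.
move=> Et.
have p3 a w : M (a :: o3 :: w) -> a = o1 \/ a = o3.
  by move=> /(eps_edge (w1 := [::])); rewrite Et; letter3 a; auto.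
have s3 b w : M (rcons (rcons w o3) b) -> b = o3 \/ b = o1.
  by rewrite -cats1 cat_rcons => /eps_edge; rewrite Et; letter3 b; auto.
have M33 : M [:: o3; o3] by apply: edge_eps; rewrite Et.
have [k k0 R] := runs okM tM URM (isT : o1 != o3) p3 s3 M33.
have [D1 D2 D3] := zetaE k.
exists k; split=> //; split.
- case=> [|a z] nz Mz; first by have := eps_edge (w1 := [::]) Mz; rewrite Et.
  have [Ea|Ea] : a = o2 \/ a = o3.
    by move: nz; have := eps_edge (w1 := [::]) Mz; rewrite Et; letter3 a; auto.
  + subst a; case: z nz Mz => [|b z] nz Mz; first by exists o2; rewrite Et.
    by move: nz; have := eps_edge (w1 := [:: o1]) Mz; rewrite Et; letter3 b.
  + subst a; have nz' : o1 \notin z by apply: contra nz; rewrite !inE => ->; rewrite !orbT.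
    have Ez : o3 :: z = nseq (size z).+1 o3.
      rewrite {1}(@run_word z) //; first by rewrite Et => b; letter3 b.
      exact: (ok_rcons okM (w := o3 :: z) (ok_cons okM Mz)).
    have /R[//|E|E] : M (o1 :: rcons (nseq (size z).+1 o3) o1) by rewrite -Ez.
    * by exists o1; rewrite Et /= D1 Ez E.
    * by exists o3; rewrite Et /= D3 Ez E nseq_rcons.
- move=> c; rewrite Et; letter3 c; rewrite /= ?D1 ?D2 ?D3 /=.
  + by apply/R; auto.
  + by apply: (@force_right [:: o1] o2); [apply: edge_eps; rewrite Et | rewrite Et; det].
  + by rewrite ?rcons_run; apply/(R k.+1); auto.
Qed.

Lemma returns : exists k, return_coding k.
Proof.
case E : t; try (by exists 1; apply: short_returns; rewrite E; tauto).
  exact: delta_returns.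
exact: zeta_returns.
Qed.

End Returns.

(** * Derived languages *)

Section Derived.
Variables (M : language) (t : kind) (k : nat).
Hypotheses (okM : extendable M) (URM : unif_rec M) (rc : return_coding M t k).

Let f := basic_morph t k.
Let fE : forall c, f c = o1 :: basic_tail t k c := basic_morphE t k.
Let tlm : forall c, o1 \notin basic_tail t k c := @basic_tail_notin t k.
Let inj : injective (basic_tail t k) := @basic_tail_inj t k.

(** The final [o1] certifies that the last block is complete; otherwise the image 12 of a letter
    under [gamma] could be the beginning of an occurrence of 123. *)
Definition derived : language := fun u => M (mapply f u ++ [:: o1]).

Lemma parse_returns z : M (o1 :: rcons z o1) -> exists v, o1 :: z = mapply f v.
Proof.
have [n Hn] : exists n, size z < n by exists (size z).+1.
elim: n z Hn => // n IH z; rewrite ltnS => sz Mz.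
have [/first_occ[s [z' [Ez ns]]]|nz] := boolP (o1 \in z); last first.
  by have [c Ec] := rc.2.1 z nz Mz; exists [:: c]; rewrite mapply1.
move: Mz; rewrite Ez => Mz.
have Ms : M (o1 :: rcons s o1).
  by move: Mz; rewrite rcons_cat rcons_cons -cat_rcons -cat_cons; exact: ok_catl.
have Mz' : M (o1 :: rcons z' o1).
  by move: Mz; rewrite rcons_cat -cat_cons; exact: ok_catr.
have [c Ec] := rc.2.1 s ns Ms.
have [|v Ev] := IH z' _ Mz'.
  by apply: leq_trans sz; rewrite Ez size_cat /= addnS ltnS leq_addl.
by exists (c :: v); rewrite mapply_cons -Ev (esym Ec : f c = _).
Qed.

Lemma derived_head u : exists z, mapply f u ++ [:: o1] = o1 :: z.
Proof. exact: mapply_head fE u. Qed.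

Lemma long_has_marker : exists N, forall w, M w -> N <= size w -> o1 \in w.
Proof.
have [N H] := URM (ok_letter okM o1); exists N => w Mw sw.
by rewrite -infix1s; exact: H.
Qed.

Lemma marked_extension w : M w -> exists s p, [/\ o1 \notin s, o1 \notin p & M (o1 :: s ++ w ++ rcons p o1)].
Proof.
move=> Mw; have [N HN] := long_has_marker.
have [x [y [sx sy H]]] := ok_extn okM N Mw.
have mx : o1 \in x by apply: HN; [exact: ok_catl H | rewrite sx].
have my : o1 \in y by apply: HN; [exact: ok_catr okM _ _ (ok_catr okM H) | rewrite sy].
have [x' [s [Ex ns]]] := last_occ mx; have [p [y' [Ey np]]] := first_occ my.
exists s, p; split=> //; move: H; rewrite Ex Ey -catA => /(ok_catr okM).
rewrite -cat_rcons !catA => /(ok_catl okM); by rewrite /= -!catA.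
Qed.

Lemma ok_derived : extendable derived.
Proof.
split.
- move=> u w /infixP[p [s ->]]; rewrite /derived !mapply_cat -!catA => /(ok_catr okM).
  have [z Ez] := derived_head s.
  by rewrite Ez -cat1s catA => /(ok_catl okM).
- move=> u /marked_extension[s [p [ns np H]]].
  have [z Ez] := derived_head u.
  have Ms : M (o1 :: rcons s o1).
    by move: H; rewrite Ez cat_cons -cat_rcons -cat_cons; exact: ok_catl.
  have Mp : M (o1 :: rcons p o1).
    by move: H; rewrite -catA -cat_cons catA => /(ok_catr okM).
  have [c Ec] := rc.2.1 s ns Ms; have [d Ed] := rc.2.1 p np Mp.
  exists c, d; rewrite /derived mapply_cons -cats1 mapply_cat mapply1 (esym Ec : f c = _) (esym Ed : f d = _).
  by move: H; rewrite -!cats1 /= -!catA.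
- by move=> c; rewrite /derived mapply1 cats1; exact: rc.2.2.
Qed.

Lemma img_derived : image_lang f derived = M.
Proof.
apply: language_eq => w; split.
- by move=> [u [Mu H]]; apply: (ok_infix okM) Mu; exact: infix_trans H (prefix_infix _ _).
- move=> /marked_extension[s [p [_ _ H]]].
  have [v Ev] : exists v, o1 :: (s ++ w ++ p) = mapply f v.
    by apply: parse_returns; move: H; rewrite !rcons_cat.
  exists v; split.
    by rewrite /derived -Ev; move: H; rewrite -cats1 /= -!catA.
  by rewrite -Ev -cat_cons infix_infix.
Qed.

(** An occurrence of [mapply f u ++ [:: o1]] starts and ends at markers, hence is aligned with
    blocks; the bound valid in [M] still serves because [mapply f] does not shorten words. *)
Lemma unif_rec_derived : unif_rec derived.
Proof.
move=> u Mu; have [N HN] := URM Mu; exists N => v Mv sv.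
have [|z1 [z2 E]] := infixP (HN _ Mv _).
  by rewrite size_cat; apply: leq_trans sv _; apply: leq_trans (size_mapply fE v) (leq_addr _ _).
have [z Ez] := derived_head u.
rewrite Ez cat_cons in E; have [v1 [v2 [-> _ E2]]] := marker_cut fE tlm E.
rewrite -cat_cons -Ez -catA /= in E2.
have [u' [v3 [-> /(mapply_inj fE tlm inj) -> _]]] := marker_cut fE tlm (esym E2).
exact: infix_infix.
Qed.

(** The two letters identified by the first left table and kept alone by the second one; [None] when
    the identity is the only table. [rpair] is the same for right tables. *)
Definition lpair (t : kind) : option (letter * letter) :=
  match t with
  | tA | tG => None | tB | tD => Some (o2, o3) | tZ | tE => Some (o1, o3) end.
Definition rpair (t : kind) : option (letter * letter) :=
  match t with
  | tA | tB => None | tG | tD | tE => Some (o2, o3) | tZ => Some (o1, o3) end.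

Definition lcond l g := if lpair t is Some (a, b) then share_left a b g else lcenter l g.
Definition rcond r g := if rpair t is Some (a, b) then share_right a b g else rcenter r g.

End Derived.

(** * Centers of the derived language and choice of an edge *)

Definition complete_check t l r : bool :=
  if good l r (eps_graph t) then
  all (fun g =>
   if all (fun la => all (fun ro => let h := graph_image la ro g in if nonempty h then good l r h else true) (right_tables t)) (left_tables t)
   then [&& treeb g, lcond t l g & rcond t r g] else true) graphs
  else true.

Lemma complete_checks : all (fun t => all (fun l => all (fun r => complete_check t l r) letters) letters) kinds.
Proof. by vm_compute. Qed.

Lemma typs_In t : List.In t kinds.
Proof. by case: t => /=; tauto. Qed.

Lemma all_nth_tabI (P : (letter -> letter -> bool) -> bool) s :
  (forall i, i < size s -> P (nth idtab s i)) -> all P s.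
Proof.
by elim: s => //= x s IH H; rewrite (H 0) // IH // => i li; exact: (H i.+1).
Qed.

(** Each pair of branching nodes [s], [p] gives the word [s f(u) 1 p], whose graph in [M] is the
    image of the graph of [u] under the two tables. Goodness of all these images pins down the graph
    of [u], which is a converse of [sound]. *)
Lemma derived_good M t k l r : extendable M -> unif_rec M -> return_coding M t k ->
  good l r (eps_graph t) -> (forall w, M w -> good l r (ext_graph M w)) ->
  forall u, derived M t k u -> [&& treeb (ext_graph (derived M t k) u),
     lcond t l (ext_graph (derived M t k) u) & rcond t r (ext_graph (derived M t k) u)].
Proof.
move=> okM URM rc ge gM u Du.
have /all_lettersP/(_ l)/all_lettersP/(_ r) := all_In complete_checks (typs_In t).
rewrite /complete_check ge => /allP/(_ _ (ext_graph_in (derived M t k) u)).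
case: ifP => // /negP[]; apply: all_nth_tabI => i li; apply: all_nth_tabI => j lj /=.
have k0 := rc.1.
rewrite -(eq_graph_image _ (lam_tab k0 li) (rho_tab k0 lj)).
rewrite -(img_graph (basic_morphE t k) (@basic_tail_notin t k) (@basic_tail_inj t k) (ok_derived okM URM rc)) ?lnode_notin ?rnode_notin //.
rewrite (img_derived okM URM rc); case: ifP => // /(nonempty_ext okM); exact: gM.
Qed.

(** On a side coded by the identity table the old center survives; on the other sides only one pair
    is known to share, and [center_of_pair] upgrades it to a center. *)
Lemma centers L t l r : extendable L -> (forall u, L u -> [&& treeb (ext_graph L u),
     lcond t l (ext_graph L u) & rcond t r (ext_graph L u)]) ->
  exists l' r', [/\ if lpair t is Some (a, b) then l' = a \/ l' = b else l' = l,
     if rpair t is Some (a, b) then r' = a \/ r' = b else r' = r &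
     forall u, L u -> good l' r' (ext_graph L u)].
Proof.
move=> okL H; have tL : tree_lang L by move=> u /H/and3P[].
have [l' Hl Gl] : exists2 l', (if lpair t is Some (a, b) then l' = a \/ l' = b else l' = l) &
    forall u, L u -> lcenter l' (ext_graph L u).
  have : forall u, L u -> lcond t l (ext_graph L u) by move=> u /H/and3P[].
  rewrite /lcond; case E: (lpair t) => [[a b]|] Hs; last by exists l.
  have [|||||l' E' Hl'] := @center_of_pair (lshare L) a b.
  - by move=> x y Hxy w /Hxy; rewrite shl_sym.
  - by move=> x w _; exact: shl_refl.
  - by move=> c; exact: center_left.
  - by move: E; case: (t) => // -[<- <-].
  - exact: Hs.
  - by exists l' => // u Lu; apply/all_lettersP => x; exact: Hl'.
have [r' Hr Gr] : exists2 r', (if rpair t is Some (a, b) then r' = a \/ r' = b else r' = r) &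
    forall u, L u -> rcenter r' (ext_graph L u).
  have : forall u, L u -> rcond t r (ext_graph L u) by move=> u /H/and3P[].
  rewrite /rcond; case E: (rpair t) => [[a b]|] Hs; last by exists r.
  have [|||||r' E' Hr'] := @center_of_pair (rshare L) a b.
  - by move=> x y Hxy w /Hxy; rewrite shr_sym.
  - by move=> x w _; exact: shr_refl.
  - by move=> c; exact: center_right.
  - by move: E; case: (t) => // -[<- <-].
  - exact: Hs.
  - by exists r' => // u Lu; apply/all_lettersP => x; exact: Hr'.
by exists l', r'; split=> // u Lu; rewrite /good (tL u Lu) Gl // Gr.
Qed.

Definition lopts t l := if lpair t is Some (a, b) then [:: a; b] else [:: l].
Definition ropts t r := if rpair t is Some (a, b) then [:: a; b] else [:: r].

Definition typ_code t := match t with tA => 0 | tB => 1 | tG => 2 | tD => 3 | tZ => 4 | tE => 5 end.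

Lemma typ_code_inj t t' : typ_code t == typ_code t' -> t = t'.
Proof. by case: t; case: t'. Qed.

(* The images of 2 and 3 play symmetric roles in [alpha], so that distinct pairs of permutations can give the same morphism. *)
Definition same_emor t (e e' : seq letter * seq letter) : bool :=
  (e == e') || (typ_code t == typ_code tA) &&
    all (fun a => label_morph e.1 tA 1 e.2 a == label_morph e'.1 tA 1 e'.2 a) letters.

Lemma same_emorP t k e e' : same_emor t e e' -> label_morph e.1 t k e.2 =1 label_morph e'.1 t k e'.2.
Proof.
case/orP=> [/eqP-> //|/andP[/typ_code_inj -> /all_lettersP H]] a.
exact/eqP/H.
Qed.

(** Completeness of the edge lists: whatever normalising permutation [p] occurs, and whichever
    letters turn out to be the new centers, some edge leaving [u] carries a suitable morphism. *)
Lemma select_edges : all (fun u => all (fun p => all (fun t =>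
  if good (perm_inv p (centers_of u).1) (perm_inv p (centers_of u).2) (eps_graph t) then
    all (fun l' => all (fun r' => has (fun v => has (fun e : seq letter * kind * seq letter =>
      let: (P, T, Q) := e in (typ_code T == typ_code t) && has (fun q =>
        [&& perm_app q (centers_of v).1 == l', perm_app q (centers_of v).2 == r' & same_emor t (P, Q) (p, q)]) perms)
       (edge_labels u v)) vtxs)
     (ropts t (perm_inv p (centers_of u).2))) (lopts t (perm_inv p (centers_of u).1))
  else true) kinds) perms) vtxs.
Proof. by vm_compute. Qed.

Lemma perm_inverse p : p \in perms -> exists p', [/\ p' \in perms, perm_app p' =1 perm_inv p & perm_inv p' =1 perm_app p].
Proof.
have H : all (fun p => has (fun p' => all (fun a => (perm_app p' a == perm_inv p a) && (perm_inv p' a == perm_app p a)) letters) perms) perms by vm_compute.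
move/(allP H)/hasP=> [p' Pp' /all_lettersP E]; exists p'; split=> // a; by have /andP[/eqP ? /eqP ?] := E a.
Qed.

Lemma img_pmorK p p' L : p \in perms -> p' \in perms -> perm_app p' =1 perm_inv p -> extendable L ->
  image_lang (perm_morph p) (image_lang (perm_morph p') L) = L.
Proof.
move=> Pp Pp' E okL; rewrite -img_comp; apply: language_eq => w; split.
- move=> [u [Lu]]; rewrite mapply_comp !mapply_pmor (eq_map E) (mapK (pinvK Pp)) => H.
  exact: (ok_infix okL H Lu).
- by move=> Lw; exists w; split=> //; rewrite mapply_comp !mapply_pmor (eq_map E) (mapK (pinvK Pp)) infix_refl.
Qed.

Lemma unif_rec_pmor p L : p \in perms -> extendable L -> unif_rec L -> unif_rec (image_lang (perm_morph p) L).
Proof.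
move=> Pp okL UR u /(img_pmor _ Pp okL)/UR[N HN]; exists N => w /(img_pmor _ Pp okL) Lw sw.
have := HN _ Lw; rewrite size_map => /(_ sw)/(infix_map (perm_app p)).
by rewrite !(mapK (pinvK Pp)).
Qed.

Definition admissible (L : language) (v : vtx) : Prop :=
  [/\ extendable L, unif_rec L & forall w, L w -> good (centers_of v).1 (centers_of v).2 (ext_graph L w)].

Lemma admissible_perm p L l r : p \in perms -> extendable L -> (forall w, L w -> good l r (ext_graph L w)) ->
  forall w, image_lang (perm_morph p) L w -> good (perm_app p l) (perm_app p r) (ext_graph (image_lang (perm_morph p) L) w).
Proof.
move=> Pp okL H w /(img_pmor _ Pp okL)/H G; rewrite -(mapK (pinvK Pp) w).
exact: good_pmor.
Qed.

Lemma Sigma3_pmor p : p \in perms -> Sigma3 (perm_morph p).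
Proof.
rewrite !inE => /or4P[|||/or3P[||]] /eqP->; rewrite /Sigma3; unfold_perms;
  [ | right | do 2 right | do 3 right | do 4 right | do 5 right]; try left;
  by move=> a; rewrite perm3E.
Qed.

Lemma SSS_emor p t k q : p \in perms -> 0 < k -> q \in perms -> SSS (label_morph p t k q).
Proof.
move=> Pp k0 Pq; exists (perm_morph p), (basic_morph t k), (perm_morph q); split=> //; try exact: Sigma3_pmor.
rewrite /S3; case: t; [by left | by right; left | by do 2 right; left | | | by do 3 right; left].
  by do 4 right; exists k; split=> //; left.
by do 4 right; exists k; split=> //; right.
Qed.

(** The language is normalised by [p'], derived with respect to 1, then renormalised by [q'] so that
    its centers are those of a vertex. The last clause records the common first letter of the
    images, the marker from which growth is later deduced. *)
Lemma step L u : admissible L u -> exists m v L', [/\ G_edge u m v, SSS m, L = image_lang m L', admissible L' v &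
  exists c, forall a, exists y, m a = c :: y].
Proof.
case=> okL UR gL; have [p' [t [Pp' Et]]] := canonical_form okL UR (good_tree (gL _ (ok_nil okL))).
have [p [Pp Ep Ep']] := perm_inverse Pp'.
set M := image_lang (perm_morph p') L in Et.
have okM : extendable M by exact: ok_img_pmor.
have URM : unif_rec M by exact: unif_rec_pmor.
have EL : L = image_lang (perm_morph p) M by rewrite img_pmorK // => a; rewrite Ep'.
have gM w : M w -> good (perm_inv p (centers_of u).1) (perm_inv p (centers_of u).2) (ext_graph M w).
  by rewrite !Ep'; exact: admissible_perm.
have tM : tree_lang M by move=> w /gM/good_tree.
have ge := gM _ (ok_nil okM); rewrite Et in ge.
have [k rc] := returns okM tM URM Et.
have [l' [r' [Hl Hr gD]]] := centers (ok_derived okM URM rc) (derived_good okM URM rc ge gM).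
have := all_In (allP (all_In select_edges (vtxs_In u)) _ Pp) (typs_In t); rewrite ge.
have Hl' : l' \in lopts t (perm_inv p (centers_of u).1).
  move: Hl; rewrite /lopts; case: (lpair t) => [[a b]|] H; rewrite !inE; last exact/eqP.
  by case: H => ->; rewrite eqxx ?orbT.
have Hr' : r' \in ropts t (perm_inv p (centers_of u).2).
  move: Hr; rewrite /ropts; case: (rpair t) => [[a b]|] H; rewrite !inE; last exact/eqP.
  by case: H => ->; rewrite eqxx ?orbT.
move=> /allP/(_ _ Hl')/allP/(_ _ Hr')/has_In[v [_ /has_In[[[P T] Q] [He]]]].
move=> /andP[/typ_code_inj ET /hasP[q Pq /and3P[/eqP El /eqP Er Eq]]]; subst T.
have [q' [Pq' Eq' _]] := perm_inverse Pq.
pose D := derived M t k; have okD : extendable D by exact: ok_derived.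
exists (label_morph p t k q), v, (image_lang (perm_morph q') D); split.
- apply/G_edgeP; exists P, t, Q, k; split=> //; first exact: rc.1.
  by move=> a; rewrite (same_emorP k Eq).
- by apply: SSS_emor => //; exact: rc.1.
- by rewrite !img_comp img_pmorK // img_derived.
- split; [exact: ok_img_pmor | apply: unif_rec_pmor => //; exact: unif_rec_derived | ].
  have -> : (centers_of v).1 = perm_app q' l' by rewrite Eq' -El pappK.
  have -> : (centers_of v).2 = perm_app q' r' by rewrite Eq' -Er pappK.
  exact: admissible_perm.
- exists (perm_app p o1) => a; exists (mapply (perm_morph p) (basic_tail t k (perm_app q a))).
  by rewrite /label_morph /mcomp mapply1 basic_morphE mapply_cons.
Qed.

(** * Shift spaces *)

Lemma size_factor x i n : size (factor x i n) = n.
Proof. exact: size_mkseq. Qed.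

Lemma factor_cat x i n m : factor x i (n + m) = factor x i n ++ factor x (i + Z.of_nat n)%Z m.
Proof.
rewrite /factor /mkseq iotaD map_cat add0n; congr (_ ++ _).
rewrite -[n in iota n m]addn0 iotaDl -map_comp; apply: eq_map => k /=; congr x; lia.
Qed.

Lemma factor_cons x i n : factor x i n.+1 = x i :: factor x (i + 1)%Z n.
Proof. by rewrite -add1n factor_cat; congr (_ :: _); congr x; lia. Qed.

Lemma factor_rcons x i n : factor x i n.+1 = rcons (factor x i n) (x (i + Z.of_nat n)%Z).
Proof. rewrite -addn1 factor_cat cats1; congr rcons; congr x; lia. Qed.

Lemma eq_factor x y i j n : (forall k, (k < n)%N -> x (i + Z.of_nat k)%Z = y (j + Z.of_nat k)%Z) ->
  factor x i n = factor y j n.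
Proof.
move=> H; apply: (@eq_from_nth _ o1); rewrite !size_factor // => k lk.
by rewrite !nth_mkseq // H.
Qed.

Lemma factor_inj x y i j n k : factor x i n = factor y j n -> (k < n)%N ->
  x (i + Z.of_nat k)%Z = y (j + Z.of_nat k)%Z.
Proof. by move=> /(congr1 (fun s => nth o1 s k)) E lk; rewrite !nth_mkseq in E. Qed.

Lemma factor_infix x i j n m : (i <= j)%Z -> (j + Z.of_nat m <= i + Z.of_nat n)%Z ->
  infix (factor x j m) (factor x i n).
Proof.
move=> H1 H2; pose a := Z.to_nat (j - i); pose b := Z.to_nat (i + Z.of_nat n - (j + Z.of_nat m)).
have -> : n = (a + (m + b))%N.
  by apply: Nat2Z.inj; rewrite -!plusE !Nat2Z.inj_add !Z2Nat.id; lia.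
rewrite !factor_cat.
have -> : (i + Z.of_nat a)%Z = j by rewrite Z2Nat.id; lia.
exact: infix_infix.
Qed.

Lemma infix_factor x i n w : infix w (factor x i n) -> exists j, factor x j (size w) = w.
Proof.
case/infixP => p [s E].
have En : n = (size p + (size w + size s))%N by rewrite -!size_cat -E size_factor.
exists (i + Z.of_nat (size p))%Z; move/eqP: E; rewrite En !factor_cat eqseq_cat ?size_factor //.
by rewrite eqseq_cat ?size_factor // => /and3P[_ /eqP].
Qed.

Lemma lang_factor (X : cset) x i n : X x -> lang X (factor x i n).
Proof. by move=> Xx; exists x; split=> //; exists i; rewrite size_factor. Qed.

Definition transl (x : config) (d : Z) : config := fun n => x (n + d)%Z.

Lemma shift_transl x d : Defs.shift (transl x d) = transl x (d + 1)%Z.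
Proof. by apply: functional_extensionality => n; rewrite /Defs.shift /transl; congr x; lia. Qed.

Lemma transl_in (X : cset) x d : shift_invariant X -> X x -> X (transl x d).
Proof.
move=> inv Xx; move: d; apply: Z.peano_ind.
- suff -> : transl x 0 = x by [].
  by apply: functional_extensionality => n; rewrite /transl; congr x; lia.
- by move=> d /inv; rewrite shift_transl.
- move=> d H; apply/inv; rewrite shift_transl.
  by have -> : (Z.pred d + 1)%Z = d by lia.
Qed.

Lemma in_closed (X : cset) x : closed_set X -> shift_invariant X ->
  (forall i n, lang X (factor x i n)) -> X x.
Proof.
move=> cl inv H; apply: cl => N.
have [y [Xy [j Ej]]] := H (- Z.of_nat N)%Z (N + N).+1.
exists (transl y (j + Z.of_nat N)%Z); split; first exact: transl_in.
move=> i Hi; rewrite size_factor in Ej.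
have lk : (Z.to_nat (i + Z.of_nat N) < (N + N).+1)%N by apply/ltP; rewrite -plusE; lia.
have := factor_inj Ej lk; rewrite Z2Nat.id; last lia.
by rewrite /transl => E; transitivity (y (j + (i + Z.of_nat N))%Z); [congr y | rewrite E; congr x]; lia.
Qed.

Lemma ok_lang X : shift_space X -> extendable (lang X).
Proof.
case=> _ _ letX; split.
- move=> u w H [x [Xx [i E]]]; rewrite -E in H.
  by have [j Ej] := infix_factor H; exists x; split=> //; exists j.
- move=> w [x [Xx [i E]]]; exists (x (i - 1)%Z), (x (i + Z.of_nat (size w))%Z).
  exists x; split=> //; exists (i - 1)%Z.
  rewrite /= size_rcons factor_cons; have -> : (i - 1 + 1)%Z = i by lia.
  by rewrite factor_rcons E.
- move=> a; have [x [Xx [i Ei]]] := letX a; exists x; split=> //; exists i.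
  by rewrite factor_cons Ei.
Qed.

Lemma dendricP X : shift_space X -> dendric X <-> tree_lang (lang X).
Proof.
move=> HX; have okL := ok_lang HX.
have E w : is_tree (ext_vertex X w) (ext_edge X w) <-> treeb (ext_graph (lang X) w).
  rewrite -(gtreeP (ext_graph_in _ _)).
  have -> : ext_vertex X w = gvertex (ext_graph (lang X) w).
    apply: functional_extensionality => -[a|b]; apply: propositional_extensionality.
      by split=> [H|/(lvP okL)//]; apply/(lvP okL).
    by split=> [H|/(rvP okL)//]; apply/(rvP okL).
  have -> : ext_edge X w = gedge (ext_graph (lang X) w).
    apply: functional_extensionality => -[a|a]; apply: functional_extensionality => -[b|b] //;
      apply: propositional_extensionality; by split=> [H|/ext_graphP//]; apply/ext_graphP.
  by [].
by split=> H w Lw; apply/E; apply: H.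
Qed.

(** * Minimality and uniform recurrence *)

Lemma unif_rec_minimal X : shift_space X -> unif_rec (lang X) -> minimal X.
Proof.
move=> HX UR Y YX clY invY; case: (classic (exists y, Y y)) => [[y Yy]|H]; last first.
  by left=> x Yx; apply: H; exists x.
right=> x; split; first exact: YX.
move=> Xx; apply: in_closed => // i n.
have [N HN] := UR _ (lang_factor i n Xx).
have := HN _ (lang_factor 0 N (YX _ Yy)); rewrite size_factor => /(_ (leqnn N))/infix_factor[j Ej].
by exists y; split=> //; exists j.
Qed.

Lemma uniform_bound (Q : letter -> nat -> Prop) :
  (forall a, exists n, Q a n) -> (forall a n m, n <= m -> Q a n -> Q a m) -> exists N, forall a, Q a N.
Proof.
move=> H mono; have [[n1 H1] [n2 H2] [n3 H3]] := And3 (H o1) (H o2) (H o3).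
exists (maxn n1 (maxn n2 n3)) => a; case: (letter_cases a) => ->; [apply: mono H1 | apply: mono H2 | apply: mono H3];
  by rewrite ?leq_max ?leqnn ?orbT.
Qed.

Section Compactness.
Variable T : word -> Prop.
Hypothesis T_nil : T [::].
Hypothesis T_ext : forall u, T u -> exists ab : letter * letter, T (ab.1 :: rcons u ab.2).

Let next (s : {u | T u}) : {ab : letter * letter | T (ab.1 :: rcons (sval s) ab.2)} :=
  constructive_indefinite_description _ (T_ext (proj2_sig s)).

Let chain (n : nat) : {u | T u} :=
  iter n (fun s => exist T _ (proj2_sig (next s))) (exist T _ T_nil).

(** Stage [n] of the chain adds the letter of index [n] on the right and the letter of index
    [- n - 1] on the left. *)
Let limit : config := fun i =>
  if (0 <=? i)%Z then (sval (next (chain (Z.to_nat i)))).2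
  else (sval (next (chain (Z.to_nat (- i - 1))))).1.

Lemma limit_factor n : factor limit (- Z.of_nat n) (n + n) = sval (chain n).
Proof.
elim: n => [|n IH] //.
rewrite addSn addnS factor_cons.
have -> : (- Z.of_nat n.+1 + 1)%Z = (- Z.of_nat n)%Z by lia.
rewrite factor_rcons IH /=.
have -> : (- Z.of_nat n + Z.of_nat (n + n))%Z = Z.of_nat n by rewrite -plusE; lia.
rewrite /limit; case: Z.leb_spec => [|_]; first lia.
case: Z.leb_spec => [_|]; last lia.
by rewrite Nat2Z.id; have -> : Z.to_nat (- - Z.of_nat n.+1 - 1) = n by lia.
Qed.

Lemma compactness : exists x : config, forall n, T (factor x (- Z.of_nat n) (n + n)).
Proof. by exists limit => n; rewrite limit_factor; exact: proj2_sig. Qed.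

End Compactness.

Lemma factor_center x i m : exists n, infix (factor x i m) (factor x (- Z.of_nat n) (n + n)).
Proof.
exists (Z.to_nat (Z.abs i + Z.of_nat m)); apply: factor_infix; rewrite -?plusE; lia.
Qed.

(** If [w] is missing from arbitrarily long words, compactness yields a point of [X] avoiding [w];
    the points of [X] avoiding [w] then form a nonempty proper closed invariant subset. *)
Lemma minimal_unif_rec X : shift_space X -> minimal X -> unif_rec (lang X).
Proof.
move=> HX minX w Lw; apply: NNPP => noN.
have [clX invX _] := HX; have okL := ok_lang HX.
pose avoid u := lang X u /\ ~ infix w u.
have avoid_infix u v : infix u v -> avoid v -> avoid u.
  move=> H [H1 H2]; split; first exact: (ok_infix okL H).
  by move=> H3; apply: H2; exact: infix_trans H3 H.
(* Avoiding [w] need not be an extendable property; occurring arbitrarily deep inside words that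
   avoid [w] is. *)
pose T u := forall n, exists x y, [/\ n <= size x, n <= size y & avoid (x ++ u ++ y)].
have T_nil : T [::].
  move=> n; apply: NNPP => H; apply: noN; exists (n + n) => v Lv sv.
  apply/negPn/negP => /negP nv; apply: H; exists (take n v), (drop n v).
  rewrite cat0s cat_take_drop; split=> //.
    by rewrite size_takel // (leq_trans _ sv) // leq_addr.
  by rewrite size_drop leq_subRL // (leq_trans _ sv) // leq_addr.
have T_ext u : T u -> exists ab : letter * letter, T (ab.1 :: rcons u ab.2).
  move=> Tu; apply: NNPP => H.
  pose Q a b n := ~ exists x y, [/\ n <= size x, n <= size y & avoid (x ++ (a :: rcons u b) ++ y)].
  have Qm a b n m : n <= m -> Q a b n -> Q a b m.
    move=> nm Hn [x [y [sx sy A]]]; apply: Hn; exists x, y; split=> //; exact: leq_trans nm _.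
  (* If each of the nine pairs of letters fails at some depth, they all fail at a common depth [N],
     which contradicts [T u] at depth [N.+1]. *)
  have [N HN] : exists N, forall a b, Q a b N.
    apply: uniform_bound => [a|a n m nm H1 b]; last exact: Qm (H1 b).
    apply: uniform_bound => [b|b n m]; last exact: Qm.
    apply: NNPP => H1; apply: H; exists (a, b) => n; apply: NNPP => H2; apply: H1; by exists n.
  have [x [y [sx sy A]]] := Tu N.+1.
  case/lastP: x sx A => [//|x a]; rewrite size_rcons ltnS => sx A.
  case: y sy A => [//|b y] /=; rewrite ltnS => sy A.
  by apply: (HN a b); exists x, y; split=> //; move: A; rewrite cat_rcons /= cat_rcons.
have [x Tx] := compactness T_nil T_ext.
have Ax i m : avoid (factor x i m).
  have [n Hn] := factor_center x i m; apply: (avoid_infix _ _ Hn).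
  have [y [z [_ _ A]]] := Tx n 0; apply: (avoid_infix) A; exact: infix_infix.
pose Y z := X z /\ forall i n, ~ infix w (factor z i n).
have [||||HY] := minX Y.
- by move=> z [].
- move=> z Hz; split.
    by apply: clX => N; have [y [[Xy _] H]] := Hz N; exists y.
  move=> i n H; have [y [[_ Hy] E]] := Hz (Z.to_nat (Z.abs i + Z.of_nat n)).
  apply: (Hy i n); suff -> : factor y i n = factor z i n by [].
  by apply: eq_factor => k /ltP lk; apply: E; lia.
- move=> z; split=> -[Xz H]; split; try first [exact: (proj1 (invX z)) | exact: (proj2 (invX z))].
    move=> i n; have -> : factor (Defs.shift z) i n = factor z (i + 1) n.
      by apply: eq_factor => k _; rewrite /Defs.shift; congr z; lia.
    exact: H.
  move=> i n; have -> : factor z i n = factor (Defs.shift z) (i - 1) n.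
    by apply: eq_factor => k _; rewrite /Defs.shift; congr z; lia.
  exact: H.
- move=> H; apply: (H x); split; last by move=> i n; case: (Ax i n).
  by apply: in_closed => // i n; case: (Ax i n).
- have [z [Xz [i Ei]]] := Lw; have [_ H] := proj2 (HY z) Xz.
  by apply: (H i (size w)); rewrite Ei infix_refl.
Qed.

(** * Directive sequences *)

Definition nonerasing (d : nat -> morph) := forall n c, d n c != [::].

Section Directive.
Variable d : nat -> morph.
Hypothesis ner : nonerasing d.

Lemma dcomp_add n k j b : dcomp d n (k + j) b = mapply (dcomp d n k) (dcomp d (n + k) j b).
Proof.
elim: j b => [|j IH] b; first by rewrite addn0 mapply1.
rewrite addnS /= /mcomp (eq_mapply IH) -mapply_comp /mcomp addnA //.
Qed.

Lemma dcomp1 n b : dcomp d n 1 b = d n b.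
Proof. by rewrite /= /mcomp addn0; elim: (d n b) => // c w IH; rewrite mapply_cons IH. Qed.

Lemma dcompS n k b : dcomp d n k.+1 b = mapply (d n) (dcomp d n.+1 k b).
Proof. by rewrite -add1n dcomp_add addn1 (eq_mapply (dcomp1 n)). Qed.

Lemma size_nonerasing (f : morph) : (forall c, f c != [::]) -> forall u, size u <= size (mapply f u).
Proof.
move=> H; elim=> // c u IH; rewrite mapply_cons size_cat; apply: (leq_add (m1 := 1)) => //.
by rewrite lt0n size_eq0.
Qed.

Lemma dcomp_nonerasing n k b : dcomp d n k b != [::].
Proof.
elim: k n b => // k IH n b; rewrite dcompS -size_eq0 -lt0n.
by apply: leq_trans (size_nonerasing (ner n) _); rewrite lt0n size_eq0.
Qed.

Definition level_lang (n : nat) : language := fun w => exists k a, 0 < k /\ infix w (dcomp d n k a).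

Section Primitive.
Hypothesis prim : primitive d.

Lemma level_letter n a : level_lang n [:: a].
Proof.
by have [k [k0 H]] := prim n; exists k, o1; split=> //; rewrite infix1s.
Qed.

Lemma level_img n : level_lang n = image_lang (d n) (level_lang n.+1).
Proof.
apply: language_eq => w; split.
- move=> [k [a [k0]]]; case: k k0 => [//|[|k]] _; rewrite dcompS => H.
    by exists [:: a]; split=> //; exact: level_letter.
  exists (dcomp d n.+1 k.+1 a); split=> //; exists k.+1, a; split=> //; exact: infix_refl.
- move=> [u [[k [a [k0 H]]] H']]; exists k.+1, a; split=> //; rewrite dcompS.
  exact: infix_trans H' (infix_mapply _ H).
Qed.

Lemma size_letters (w : word) : (forall a, a \in w) -> 2 < size w.
Proof.
move=> H; have -> : 3 = size letters by [].
by apply: uniq_leq_size.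
Qed.

(** Primitivity makes a high enough image contain three consecutive letters [c1 c2 c3]. An
    occurrence of [w] inside the block of [c2] is then flanked by the nonempty images of the other
    two. *)
Lemma ok_level n : extendable (level_lang n).
Proof.
split.
- move=> u w H [k [a [k0 H']]]; exists k, a; split=> //; exact: infix_trans H H'.
- move=> w [k [a [k0 /infixP[z1 [z2 E]]]]].
  have [k1 [k10 H1]] := prim (n + k); have [k2 [k20 H2]] := prim (n + k + k1).
  case E2 : (dcomp d (n + k + k1) k2 o1) => [|c1 [|c2 [|c3 v]]];
    try by have := size_letters (H2^~ o1); rewrite E2.
  have [p [s Es]] : exists p s, dcomp d (n + k) k1 c2 = p ++ a :: s.
    by have [s [p [-> _]]] := first_occ (H1 a c2); exists s, p.
  pose f := dcomp d n k; pose g := dcomp d (n + k) k1.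
  have [x0 [a0 Ex]] : exists x0 a0, mapply f (g c1 ++ p) = rcons x0 a0.
    have : size (g c1 ++ p) <= size (mapply f (g c1 ++ p)).
      by apply: size_nonerasing => c; exact: dcomp_nonerasing.
    case/lastP: (mapply f _) => [|x0 a0]; last by exists x0, a0.
    by rewrite leqn0 size_cat addn_eq0 size_eq0 (negbTE (dcomp_nonerasing _ _ _)).
  have [b0 [y0 Ey]] : exists b0 y0, mapply f (s ++ g c3 ++ mapply g v) = b0 :: y0.
    have : size (s ++ g c3 ++ mapply g v) <= size (mapply f (s ++ g c3 ++ mapply g v)).
      by apply: size_nonerasing => c; exact: dcomp_nonerasing.
    case: (mapply f _) => [|b0 y0]; last by exists b0, y0.
    by rewrite leqn0 !size_cat !addn_eq0 !size_eq0 (negbTE (dcomp_nonerasing _ _ c3)) andbF.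
  have [a' [b' I]] := infix_neighbours a0 b0 x0 y0 z1 w z2.
  exists a', b', (k + (k1 + k2)), o1; split; first by rewrite addn_gt0 k0.
  rewrite dcomp_add dcomp_add E2 !mapply_cons -/f -/g [g c2]Es.
  have -> : g c1 ++ (p ++ a :: s) ++ g c3 ++ mapply g v =
     (g c1 ++ p) ++ a :: (s ++ g c3 ++ mapply g v) by rewrite -!catA.
  by rewrite mapply_cat mapply_cons Ex Ey [f a]E.
- exact: level_letter.
Qed.

Lemma block_infix (f : morph) M w v : (forall c, size (f c) <= M) -> M + M < size w ->
  infix w (mapply f v) -> exists c, infix (f c) w.
Proof.
move=> HM sw; elim: v => [|c v IH].
  by rewrite infixs0 => /eqP E; rewrite E in sw.
move=> /infixP[z1 [z2]]; rewrite mapply_cons => /cat_split[[k [_ E]]|[c' [k [E1 E2]]]].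
  by apply: IH; apply/infixP; exists k, z2.
have sk : size (c' :: k) <= M.
  by apply: leq_trans (HM c); rewrite E1 size_cat leq_addl.
case: v E2 {IH} => [|e v].
  rewrite cats0 => E2; have : size w <= M.
    by apply: leq_trans sk; rewrite -E2 size_cat leq_addr.
  by rewrite leqNgt (leq_ltn_trans (leq_addr M M) sw).
rewrite mapply_cons -cat_cons catA => /eqP E2.
have [r Er] : exists r, w = ((c' :: k) ++ f e) ++ r.
  set A := (c' :: k) ++ f e; exists (drop (size A) w).
  have sA : size A <= size w.
    by rewrite size_cat; apply: leq_trans (ltnW sw); apply: leq_add.
  rewrite -{1}(cat_take_drop (size A) w); congr (_ ++ _).
  have /eqP/(congr1 (take (size A))) := E2.
  by rewrite [RHS]take_size_cat // takel_cat.
by exists e; rewrite Er -catA infix_infix.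
Qed.

Lemma dcomp_bound n J : exists M, forall j c, j <= J -> size (dcomp d n j c) <= M.
Proof.
elim: J => [|J [M HM]]; first by exists 1 => j c; rewrite leqn0 => /eqP->.
pose m := \max_(c <- letters) size (dcomp d n J.+1 c).
exists (maxn M m) => j c; rewrite leq_eqVlt => /orP[/eqP->|H].
  by rewrite leq_max; apply/orP; right; apply: leq_bigmax_seq => //; exact: mem_letters.
by rewrite leq_max HM.
Qed.

Lemma unif_rec_level n : unif_rec (level_lang n).
Proof.
move=> u [k [a [k0 Iu]]]; have [K [K0 HK]] := prim (n + k).
have Ib b : infix u (dcomp d n (k + K) b).
  have [s [p [E _]]] := first_occ (HK a b).
  rewrite dcomp_add E mapply_cat mapply_cons; apply: infix_trans Iu _; exact: infix_infix.
have [M HM] := dcomp_bound n (k + K).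
(* [M] bounds the images through all numbers of morphisms up to [k + K], which are thus too short to
   contain [w]; beyond, [w] exceeds two blocks and so contains a whole one. *)
exists (M + M).+1 => w [j [c [j0 Iw]]] sw.
have [lj|lj] := leqP j (k + K).
  have := leq_trans sw (leq_trans (size_infix Iw) (HM j c lj)).
  by rewrite ltnNge leq_addr.
move: Iw; rewrite -(subnKC (ltnW lj)) dcomp_add => /(block_infix _ sw)[c'|e He].
  exact: HM.
exact: infix_trans (Ib e) He.
Qed.

End Primitive.
End Directive.

(** * The two implications *)

Lemma label_morph_nonerasing p t k q : forall a, label_morph p t k q a != [::].
Proof. by move=> a; rewrite /label_morph /mcomp mapply1 basic_morphE mapply_cons. Qed.

Lemma Sigma3P m : Sigma3 m -> exists2 p, p \in perms & m =1 perm_morph p.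
Proof.
rewrite /Sigma3; unfold_perms => -[|[|[|[|[|]]]]] E; 
  match type of E with _ =1 perm3 ?a ?b ?c => exists [:: a; b; c] => //; move=> x; rewrite E; exact: perm3E end.
Qed.

Lemma level_good d v : nonerasing d -> primitive d -> (forall n, G_edge (v n) (d n.+1) (v n.+1)) ->
  forall n w, level_lang d n.+1 w -> good (centers_of (v n)).1 (centers_of (v n)).2 (ext_graph (level_lang d n.+1) w).
Proof.
move=> ner prim E n w; have [N] : exists N, size w < N by exists (size w).+1.
elim: N n w => // N IH n w; rewrite ltnS => sw; rewrite (level_img prim) => Lw.
apply: sound_edge (E n) (ok_level ner prim _) Lw _ => u su Lu.
by apply: IH => //; exact: leq_trans su sw.
Qed.

Theorem sufficiency (X : cset) (HX : shift_space X) pi0 sigma v :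
  Sigma3 pi0 -> (forall k, SSS (sigma k) /\ G_edge (v k) (sigma k) (v k.+1)) ->
  primitive (dseq pi0 sigma) -> (forall x, X x <-> generated_shift (dseq pi0 sigma) x) ->
  minimal X /\ dendric X.
Proof.
move=> /Sigma3P[p Pp Ep] He; set d := dseq pi0 sigma => prim HG.
have ner : nonerasing d.
  case=> [|n] c; first by rewrite /d /= Ep.
  have [_ /G_edgeP[P [t [Q [k [_ _ E]]]]]] := He n; rewrite /d /= E; exact: label_morph_nonerasing.
have URL : unif_rec (level_lang d 0) by exact: unif_rec_level.
have EL : lang X = level_lang d 0.
  apply: language_eq => w; split=> [[x [/HG Xx [i Ei]]]|Lw]; first by rewrite -Ei; exact: Xx.
  (* Every letter occurs in [X], so [X] has a point; by uniform recurrence this single point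
     contains every word of the level language. *)
  have [_ _ letX] := HX; have [x [Xx _]] := letX o1.
  have [N HN] := URL w Lw; have := HN _ (proj1 (HG x) Xx 0%Z N).
  by rewrite size_factor => /(_ (leqnn N))/infix_factor[j Ej]; exists x; split=> //; exists j.
split; first by apply: unif_rec_minimal => //; rewrite EL.
apply/(dendricP HX); rewrite EL => w; rewrite (level_img prim) (eq_img _ (Ep : d 0 =1 _)).
have okL := ok_level ner prim 1.
move=> /(img_pmor _ Pp okL) Lw; rewrite -(mapK (pinvK Pp) w).
apply: good_tree; apply: good_pmor => //; apply: (level_good (v := v) ner prim) => // n.
exact: (He n).2.
Qed.

Lemma vertex_of (l r : letter) : exists p v, [/\ p \in perms, perm_app p l = (centers_of v).1 & perm_app p r = (centers_of v).2].
Proof.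
have : all (fun l => all (fun r => has (fun p => has (fun v =>
  (perm_app p l == (centers_of v).1) && (perm_app p r == (centers_of v).2)) vtxs) perms) letters) letters by vm_compute.
move=> /all_lettersP/(_ l)/all_lettersP/(_ r)/hasP[p Pp /has_In[v [_ /andP[/eqP H1 /eqP H2]]]].
by exists p, v.
Qed.

Lemma tree_centers L : extendable L -> tree_lang L -> exists l r, forall w, L w -> good l r (ext_graph L w).
Proof.
move=> okL tL; have [a na Ha] := center_left o1 okL tL; have [b nb Hb] := center_right o1 okL tL.
have [|||||l _ Hl] := @center_of_pair (lshare L) o1 a.
- by move=> x y Hxy w /Hxy; rewrite shl_sym.
- by move=> x w _; exact: shl_refl.
- by move=> c; exact: center_left.
- by rewrite eq_sym.
- exact: Ha.
have [|||||r _ Hr] := @center_of_pair (rshare L) o1 b.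
- by move=> x y Hxy w /Hxy; rewrite shr_sym.
- by move=> x w _; exact: shr_refl.
- by move=> c; exact: center_right.
- by rewrite eq_sym.
- exact: Hb.
exists l, r => w Lw; rewrite /good (tL w Lw) /=; apply/andP; split; apply/all_lettersP => x.
  exact: Hl.
exact: Hr.
Qed.

Section Necessity.
Variables (d : nat -> morph) (LL : nat -> language) (m : nat -> letter).
Hypothesis ner : nonerasing d.
Hypothesis okLL : forall n, extendable (LL n).
Hypothesis URLL : forall n, unif_rec (LL n).
Hypothesis imgLL : forall n, LL n = image_lang (d n) (LL n.+1).
Hypothesis marker : forall n a, exists y, d n.+1 a = m n :: y.

Lemma levels_mapply n u : LL n.+1 u -> LL n (mapply (d n) u).
Proof. by move=> Lu; rewrite imgLL; exists u; split=> //; exact: infix_refl. Qed.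

Lemma levels_dcomp n k a : LL n (dcomp d n k a).
Proof.
elim: k n => [|k IH] n; first exact: (ok_letter (okLL n)).
by rewrite dcompS; exact/levels_mapply/IH.
Qed.

(* Otherwise each level maps the marker of the next level to its own marker alone, and then every power of the marker occurs, against uniform recurrence. *)
Lemma marker_growth n : exists K, 0 < K /\ forall b, 1 < size (dcomp d n.+1 K b).
Proof.
apply: NNPP => H.
(* Some [b] has an image of length at most one through [i.+2] morphisms. The first morphism applied
   to it produces a marker, and the following ones cannot shorten what comes from that marker. *)
have short i : d (n + i).+1 (m (n + i).+1) = [:: m (n + i)].
  have [b Hb] : exists b, size (dcomp d n.+1 i.+2 b) <= 1.
    apply: NNPP => H1; apply: H; exists i.+2; split=> // b.
    by rewrite ltnNge; apply/negP => H2; apply: H1; exists b.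
  rewrite -[i.+2]addn1 dcomp_add dcomp1 addSn in Hb.
  have [y Ey] := marker (n + i.+1) b; rewrite Ey mapply_cons size_cat in Hb.
  have {}Hb : size (dcomp d n.+1 (i + 1) (m (n + i.+1))) <= 1.
    by rewrite addn1; exact: leq_trans (leq_addr _ _) Hb.
  rewrite dcomp_add dcomp1 addSn in Hb.
  have := leq_trans (size_nonerasing (dcomp_nonerasing ner n.+1 i) _) Hb.
  by rewrite addnS; have [z ->] := marker (n + i) (m (n + i).+1); case: z.
(* By [short], a power of the marker is sent to the same power one level down, and the image of the
   next letter [c] begins with one more marker: each level gains one. *)
have pow j : forall i, LL (n + i).+1 (nseq j (m (n + i))).
  elim: j => [|j IH] i; first exact: ok_nil (okLL _).
  have [c Hc] := ok_extr (okLL _) (IH i.+1).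
  have := levels_mapply; move=> /(_ (n + i).+1 (rcons (nseq j (m (n + i).+1)) c)).
  rewrite addnS in Hc; move=> /(_ Hc); rewrite -cats1 mapply_cat mapply1.
  have -> : mapply (d (n + i).+1) (nseq j (m (n + i).+1)) = nseq j (m (n + i)).
    by elim: (j) => // j' E; rewrite /= mapply_cons short E.
  have [y ->] := marker (n + i) c; rewrite -cat_rcons => /(ok_catl (okLL _)).
  by rewrite -cats1 -(nseqD j 1) addn1.
have [e [_ [ne _ _ _]]] := other_letters (m n).
have [N HN] := URLL (ok_letter (okLL n.+1) e).
have := pow N 0; rewrite addn0 => /HN; rewrite size_nseq leqnn infix1s mem_nseq => /(_ isT).
by rewrite (negbTE ne) andbF.
Qed.

Lemma growth n : exists K, 0 < K /\ forall b, 1 < size (dcomp d n K b).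
Proof.
case: n => [|n]; last exact: marker_growth.
have [K [K0 H]] := marker_growth 0; exists K.+1; split=> // b.
rewrite dcompS; exact: leq_trans (H b) (size_nonerasing (ner 0) _).
Qed.

Lemma unbounded_growth i n : exists K, 0 < K /\ forall b, i < size (dcomp d n K b).
Proof.
elim: i n => [|i IH] n.
  by exists 1; split=> // b; rewrite lt0n size_eq0; exact: dcomp_nonerasing.
have [K1 [K10 H1]] := growth n; have [K2 [K20 H2]] := IH (n + K1).
exists (K1 + K2); split=> [|b]; first by rewrite addn_gt0 K10.
rewrite dcomp_add; have D u : (size u).*2 <= size (mapply (dcomp d n K1) u).
  by elim: u => // c u IHu; rewrite mapply_cons size_cat doubleS -add2n leq_add.
apply: leq_trans (D _); rewrite -addnn -(addn1 i.+1); apply: leq_add; first exact: H2.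
exact: leq_trans (H2 b).
Qed.

(** Images grow without bound and belong to the language of their level, where uniform recurrence
    puts every letter in each long word. *)
Lemma levels_primitive : primitive d.
Proof.
move=> n; have [N HN] : exists N, forall a w, LL n w -> N <= size w -> a \in w.
  apply: uniform_bound => [a|a N M NM H w Lw sw]; last by apply: H => //; exact: leq_trans sw.
  have [N HN] := URLL (ok_letter (okLL n) a); exists N => w Lw sw.
  by rewrite -infix1s; exact: HN.
have [K [K0 HK]] := unbounded_growth N n; exists K; split=> // a b.
by apply: HN; [exact: levels_dcomp | exact: ltnW].
Qed.

Lemma levels_slang w : LL 0 w <-> slang d w.
Proof.
split=> [Lw|[k [a [_ H]]]]; last exact: (ok_infix (okLL 0) H (levels_dcomp 0 k a)).
have [N HN] := URLL Lw; have [K [K0 HK]] := unbounded_growth N 0.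
by exists K, o1; split=> //; apply: HN; [exact: levels_dcomp | exact: ltnW].
Qed.

End Necessity.

(** The invariant is bundled with the data so that iterating a chosen successor produces the whole
    infinite path. *)
Definition state := {Lv : language * vtx | admissible Lv.1 Lv.2}.

Definition follows (s : state) (ms : morph * state) : Prop :=
  [/\ G_edge (sval s).2 ms.1 (sval ms.2).2, SSS ms.1, (sval s).1 = image_lang ms.1 (sval ms.2).1 &
      exists c, forall a, exists y, ms.1 a = c :: y].

Lemma state_step (s : state) : exists ms, follows s ms.
Proof.
case: s => [[L u] G]; have [m [v [L' [H1 H2 H3 H4 H5]]]] := step G.
by exists (m, exist _ (L', v) H4).
Qed.

Theorem necessity (X : cset) (HX : shift_space X) : minimal X -> dendric X ->
  exists (pi0 : morph) (sigma : nat -> morph) (v : nat -> vtx),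
    [/\ Sigma3 pi0,
        (forall k, SSS (sigma k) /\ G_edge (v k) (sigma k) (v k.+1)),
        primitive (dseq pi0 sigma) &
        forall x, X x <-> generated_shift (dseq pi0 sigma) x].
Proof.
move=> /(minimal_unif_rec HX) UR /(dendricP HX) tL; have okL := ok_lang HX.
have [l [r gL]] := tree_centers okL tL; have [p [v0 [Pp Hl Hr]]] := vertex_of l r.
have [p' [Pp' Ep' Ep]] := perm_inverse Pp.
have G0 : admissible (image_lang (perm_morph p) (lang X)) v0.
  split; [exact: ok_img_pmor | exact: unif_rec_pmor | ].
  by rewrite -Hl -Hr; exact: admissible_perm.
pose next s := sval (constructive_indefinite_description _ (state_step s)).
have nextP s : follows s (next s) := proj2_sig (constructive_indefinite_description _ (state_step s)).
pose st n := iter n (fun s => (next s).2) (exist _ (image_lang (perm_morph p) (lang X), v0) G0 : state).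
pose sigma n := (next (st n)).1; pose v n := (sval (st n)).2.
(* The offset by one comes from the initial permutation: level 0 is the language of [X] itself, and
   the path in the graph starts at level 1. *)
pose LL n := if n is n'.+1 then (sval (st n')).1 else lang X.
exists (perm_morph p'), sigma, v.
have Gst n : admissible (sval (st n)).1 (sval (st n)).2 := proj2_sig (st n).
have He k : SSS (sigma k) /\ G_edge (v k) (sigma k) (v k.+1) by case: (nextP (st k)).
set d := dseq (perm_morph p') sigma.
have ner : nonerasing d.
  case=> [|n] c //; have [_ /G_edgeP[P [t [Q [k [_ _ E]]]]]] := He n.
  by rewrite /d /= E; exact: label_morph_nonerasing.
have okLL n : extendable (LL n) by case: n => [//|n]; case: (Gst n).
have URLL n : unif_rec (LL n) by case: n => [//|n]; case: (Gst n).
have imgLL n : LL n = image_lang (d n) (LL n.+1).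
  case: n => [|n]; last by case: (nextP (st n)).
  by rewrite /LL /d /= img_pmorK // => a; rewrite -Ep (pappK Pp').
have mk n : exists c, forall a, exists y, d n.+1 a = c :: y by case: (nextP (st n)).
pose m n := sval (constructive_indefinite_description _ (mk n)).
have marker n a : exists y, d n.+1 a = m n :: y.
  by rewrite /m; case: constructive_indefinite_description.
split=> //; first exact: Sigma3_pmor.
  exact: (levels_primitive ner okLL URLL imgLL marker).
have S := levels_slang ner okLL URLL imgLL marker.
have [clX invX _] := HX.
move=> x; split=> [Xx i n|Gx]; first by apply/S; exact: lang_factor.
by apply: in_closed => // i n; apply/S.
Qed.

(* sigma k stands for sigma_{k+1} and v k for v_{k+1} (0-indexed). *)
Theorem theorem1p1 (X : cset) (HX : shift_space X) :
  minimal X /\ dendric X <->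
  exists (pi0 : morph) (sigma : nat -> morph) (v : nat -> vtx),
    [/\ Sigma3 pi0,
        (forall k, SSS (sigma k) /\ G_edge (v k) (sigma k) (v k.+1)),
        primitive (dseq pi0 sigma) &
        forall x, X x <-> generated_shift (dseq pi0 sigma) x].
Proof.
split=> [[minX dX]|[pi0 [sigma [v [H1 H2 H3 H4]]]]]; first exact: necessity.
exact: sufficiency H1 H2 H3 H4.
Qed.
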